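(* Let $F$ be an infinitely divisible distribution on $[0,\infty)$ with Laplace transform $$\int_0^\infty e^{-\lambda x}F(dx)=\exp\Big(-a\lambda-\int_0^\infty(1-e^{-\lambda x})\,\nu(dx)\Big),\quad\lambda\ge0,$$ where $a\ge0$ and $\nu$ is a Borel measure on $(0,\infty)$ with $0<\mu:=\nu((1,\infty))<\infty$ and $\int_0^1x\,\nu(dx)<\infty$. Put $G(B)=\nu(B\cap(1,\infty))/\mu$. Let $0<T\le\infty$, $\Delta=(0,T]$, and if $T<\infty$ assume $G\in\mathcal L_\Delta$. Then $G\in\mathcal S_\Delta$ if and only if $\nu(x+\Delta)\sim F(x+\Delta)$ as $x\to\infty$.
   Context: For $0<T\le\infty$, $x+\Delta=(x,x+T]$. $G\in\mathcal L_\Delta$ means $G(x+\Delta)>0$ for all large $x$ and $G(x+t+\Delta)/G(x+\Delta)\to1$ as $x\to\infty$ uniformly in $t\in[0,1]$. A distribution $G$ on $[0,\infty)$ with unbounded support is in $\mathcal S_\Delta$ if $G\in\mathcal L_\Delta$ and $(G*G)(x+\Delta)\sim2G(x+\Delta)$. $a\sim b$ means $a/b\to1$. *)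

(* Defs.v *)
From HB Require Import structures.
From mathcomp Require Import all_boot all_order all_algebra.
From mathcomp Require Import all_classical all_reals all_analysis.
Set Implicit Arguments. Unset Strict Implicit. Unset Printing Implicit Defensive.
Import Order.TTheory GRing.Theory Num.Theory.
Import numFieldNormedType.Exports.
Local Open Scope classical_set_scope.
Local Open Scope ring_scope.

Definition shiftD {R : realType} (T : \bar R) (x : R) : set R :=
  [set y | x < y /\ (y%:E <= x%:E + T)%E].

Definition asymp_equiv {R : realType} (a b : R -> R) : Prop :=
  (fun x => a x / b x) @ +oo --> (1 : R).

Definition conv {R : realType} (m1 m2 : {measure set R -> \bar R})
  (B : set R) : \bar R :=
  (\int[m1]_x \int[m2]_y (\1_B (x + y) : R)%:E)%E.

Definition in_L_Delta {R : realType} (T : \bar R) (G : set R -> \bar R) : Prop :=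
  (\forall x \near +oo, (0 < G (shiftD T x))%E) /\
  (forall e : R, 0 < e -> \forall x \near +oo, forall t : R, 0 <= t <= 1 ->
     `| fine (G (shiftD T (x + t))) / fine (G (shiftD T x)) - 1 | < e).

Definition in_S_Delta {R : realType} (T : \bar R)
  (G : {measure set R -> \bar R}) : Prop :=
  G (`]-oo, 0[)%classic = 0%E /\
  (forall x : R, (0 < G (`]x, +oo[)%classic)%E) /\
  in_L_Delta T G /\
  asymp_equiv (fun x => fine (conv G G (shiftD T x)))
              (fun x => 2 * fine (G (shiftD T x))).

(* Main.v *)
(* Let CP be the compound Poisson law with jump measure nu restricted to (1, oo),
   i.e. the sum of exp(-mu) mu^n/n! G^{*n}.  Splitting (0, 1] into countably many
   pieces bounded away from 0, F is the limit of H_k * CP, where H_k is the law of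
   a plus the jumps from the first k pieces.  The H_k have uniformly bounded
   exponential moments, and the tails of H_k * CP increase with k, so that
   convergence of Laplace transforms yields F(x + Delta) = lim (H_k * CP)(x + Delta)
   for every x.
   If G is in S_Delta, a Kesten bound G^{*n}(x + Delta) <= r^n G(x + Delta) gives
   CP(x + Delta) ~ mu G(x + Delta); convolving with H_k changes this by a factor
   close to 1, uniformly in k.
   Conversely, liminf G^{*n}(x + Delta) / G(x + Delta) >= n for every n, so
   F(x + Delta) ~ mu G(x + Delta) forces limsup (G * G)(x + Delta) / G(x + Delta) <= 2.
   For T = oo this needs no long-tailedness of G, which then follows from
   (G * G)(x, oo) >= G(x - 1, oo) G(1, A] + G(x, oo) G[0, A], as G(1, oo) = 1. *)

Require Import Defs.
From HB Require Import structures.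
From mathcomp Require Import all_boot all_order all_algebra.
From mathcomp Require Import all_classical all_reals all_analysis.
From mathcomp Require Import measurable_realfun ring lra.
Import Order.TTheory GRing.Theory Num.Theory.
Import numFieldNormedType.Exports.
Local Open Scope classical_set_scope.
Local Open Scope ring_scope.

(** * Convolution of probability measures on the line *)

(** Two points shape the argument. First, the limit k -> oo is taken at a fixed x, so bounds on H_k
    * CP must start at an x that does not depend on k. Only two features of H_k enter: it lives on
    the half-line and its moment of e^X is bounded uniformly in k. The latter holds because e^x - 1
    <= e x on (0, 1], so the small jumps cost at most a factor exp(e times the integral of x over
    (0, 1]). Second, in the converse an upper bound for F(x + Delta) controls (G * G)(x - y + Delta)
    only averaged over y in a bounded range, and G * G is not yet known to be long-tailed. For T =
    oo it is monotone. For T < oo one conditions on one summand and shifts the other by the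
    long-tailedness of G, except where that other mass would be evaluated below a fixed level A; the
    exceptional parts at the two points agree up to a small multiple of G(x + Delta), which the
    argument tolerates. *)

Definition addp {R : realType} (z : R * R) : R := z.1 + z.2.

Lemma measurable_addp {R : realType} : measurable_fun [set: R * R] (@addp R).
Proof. exact: measurable_funD. Qed.

HB.instance Definition _ (R : realType) :=
  @isMeasurableFun.Build _ _ (R * R)%type R (@addp R) measurable_addp.

(** As an image of the product measure this is a probability by construction, and events of the pair
    can be cut out before summing. *)
Definition convp {R : realType} (P Q : probability R R) : probability R R :=
  distribution (P \x Q)%E (@addp R).

Lemma ge0_integral_convp {R : realType} (P Q : probability R R) (f : R -> \bar R) :
  measurable_fun setT f -> (forall x, 0 <= f x)%E ->
  (\int[convp P Q]_x f x = \int[P]_x \int[Q]_y f (x + y)%R)%E.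
Proof.
move=> mf f0; rewrite /convp ge0_integral_distribution//.
apply: fubini_tonelli1 => [|z]; last exact: f0.
by apply: measurableT_comp => //; exact: measurable_addp.
Qed.

Section real_probability.
Context {d} {T : measurableType d} {R : realType} (P : probability T R).

Definition pr (A : set T) : R := fine (P A).

Lemma prE A : measurable A -> P A = (pr A)%:E.
Proof. by move=> mA; rewrite /pr fineK// fin_num_measure. Qed.

Lemma pr_ge0 A : 0 <= pr A.
Proof. exact: fine_ge0. Qed.

Lemma pr_le1 A : measurable A -> pr A <= 1.
Proof. by move=> mA; rewrite -lee_fin -prE// probability_le1. Qed.

Lemma le_pr A B : measurable A -> measurable B -> A `<=` B -> pr A <= pr B.
Proof.
by move=> mA mB AB; rewrite -lee_fin -!prE// le_measure// inE.
Qed.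

Lemma prU A B : measurable A -> measurable B -> [disjoint A & B] ->
  pr (A `|` B) = pr A + pr B.
Proof.
move=> mA mB AB; apply: EFin_inj.
by rewrite EFinD -!prE ?measureU//; [apply/eqP; rewrite -disj_set2E|exact: measurableU].
Qed.

Lemma prU_le A B : measurable A -> measurable B -> pr (A `|` B) <= pr A + pr B.
Proof.
move=> mA mB; rewrite -lee_fin EFinD -!prE//; last exact: measurableU.
exact: measureU2.
Qed.

Lemma prT : pr setT = 1.
Proof. by rewrite /pr probability_setT. Qed.

Lemma prC A : measurable A -> pr (~` A) = 1 - pr A.
Proof.
move=> mA; apply: EFin_inj.
by rewrite -prE ?probability_setC ?EFinB ?prE//; exact: measurableC.
Qed.

End real_probability.

Section slices.
Context {R : realType}.
Implicit Types P Q : probability R R.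

(** Negative [al] is allowed because the factor [n%:R - d] of [convpow_lower] is negative at n =
    0. *)
Lemma pr_prod_ge P Q (E : set (R * R)) (U : set R) (al : R) :
  measurable E -> measurable U ->
  (forall y, U y -> al <= pr Q (xsection E y)) ->
  al * pr P U <= pr (P \x Q)%E E.
Proof.
move=> mE mU h.
have mxs : measurable_fun setT (fun y => Q (xsection E y)).
  exact: measurable_fun_xsection.
rewrite -lee_fin -prE//.
rewrite EFinM -prE// -integral_cst// /product_measure1/=.
apply: (@le_trans _ _ (\int[P]_(y in U) Q (xsection E y))%E).
  have [al0|al0] := leP 0 al.
    apply: ge0_le_integral => //.
    - exact: measurable_funTS.
    - by move=> x Ux; rewrite /= prE ?lee_fin ?h//; exact: measurable_xsection.
  apply: (@le_trans _ _ 0%E); last exact: integral_ge0.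
  by rewrite integral_cst// mule_le0_ge0// lee_fin ltW.
by apply: ge0_subset_integral.
Qed.

(** The comparison is asked on a set [W] of full measure only: bounds such as
    [locmass Q (x - y) <= al] are available for y >= 0, where the laws live. *)
Lemma pr_prod_le P Q Q' (E E' : set (R * R)) (W : set R) (C : R) :
  measurable E -> measurable E' -> measurable W -> P (~` W) = 0%E -> 0 <= C ->
  (forall y, W y -> pr Q (xsection E y) <= C * pr Q' (xsection E' y)) ->
  pr (P \x Q)%E E <= C * pr (P \x Q')%E E'.
Proof.
move=> mE mE' mW PW C0 h.
have mxs (q : probability R R) (F : set (R * R)) : measurable F ->
    measurable_fun setT (fun y => q (xsection F y)).
  by move=> mF; exact: measurable_fun_xsection.
rewrite -lee_fin EFinM -!prE// /product_measure1/=.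
rewrite -ge0_integralZl//; last exact: mxs.
apply: ae_ge0_le_integral => //.
- exact: mxs.
- by move=> x _; rewrite mule_ge0.
- by apply: emeasurable_funM => //; exact: mxs.
- exists (~` W); split => //; first exact: measurableC.
  move=> y /= hy Wy; apply: hy => _.
  by rewrite !prE -?EFinM ?lee_fin ?h//; exact: measurable_xsection.
Qed.

End slices.

Lemma pr_prodC {R : realType} (P Q : probability R R) (E : set (R * R)) :
  measurable E -> pr (P \x Q)%E E = pr (Q \x P)%E ((fun z => (z.2, z.1)) @^-1` E).
Proof.
move=> mE; rewrite /pr /product_measure1/=; congr fine.
have := @indic_fubini_tonelli _ _ R R R P Q E mE.
rewrite indic_fubini_tonelli_FE// indic_fubini_tonelli_GE// => ->.
Qed.

Lemma pr_prodXT {R : realType} (P Q : probability R R) (U : set R) :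
  measurable U -> pr (P \x Q)%E (U `*` setT) = pr P U.
Proof.
move=> mU; rewrite /pr; congr fine.
rewrite -[RHS]mule1 -(probability_setT Q).
exact: (@product_measure1E _ _ R R R P Q U setT mU measurableT).
Qed.

(** * Mass of x + Delta under a convolution *)

Section local_mass.
Context {R : realType} (T : \bar R).
Implicit Types P Q G H : probability R R.

Lemma measurable_shiftD (x : R) : measurable (shiftD T x).
Proof.
have -> : shiftD T x = `]x, +oo[%classic `&` [set y | (y%:E <= x%:E + T)%E].
  by apply/seteqP; split => y; rewrite /shiftD /= in_itv/= andbT.
apply: measurableI => //.
case: T => [r||].
- have -> : [set y | (y%:E <= x%:E + r%:E)%E] = `]-oo, (x + r)]%classic.
    by apply/seteqP; split => y; rewrite /= in_itv/= -EFinD lee_fin.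
  exact: measurable_itv.
- by have -> : [set y | (y%:E <= x%:E + +oo)%E] = setT;
    [apply/seteqP; split => y //= _; rewrite addey// leey|].
- have -> : [set y : R | (y%:E <= x%:E + -oo)%E] = set0; last exact: measurable0.
  by apply/seteqP; split => y //=; rewrite leNgt ltNyr.
Qed.

Lemma shiftDD (x y z : R) : shiftD T x (y + z) <-> shiftD T (x - y) z.
Proof.
rewrite /shiftD/= ltrBlDl.
suff -> : ((y + z)%:E <= x%:E + T)%E = (z%:E <= (x - y)%:E + T)%E by [].
case: T => [r||].
- by rewrite -!EFinD !lee_fin; apply/idP/idP => ?; lra.
- by rewrite !addey// !leey.
- by rewrite /= !leNgt !ltNyr.
Qed.

Definition locmass P (x : R) : R := pr P (shiftD T x).

Lemma locmass_ge0 P x : 0 <= locmass P x. Proof. exact: pr_ge0. Qed.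

Lemma locmass_le1 P x : locmass P x <= 1.
Proof. by apply: pr_le1; exact: measurable_shiftD. Qed.

Lemma EFin_locmass P x : P (shiftD T x) = (locmass P x)%:E.
Proof. by rewrite prE//; exact: measurable_shiftD. Qed.

Let ev (x : R) (U V : set R) : set (R * R) :=
  (U `*` V) `&` (@addp R @^-1` shiftD T x).

Let jt P Q x U V := pr (P \x Q)%E (ev x U V).

Let mev x (U V : set R) : measurable U -> measurable V -> measurable (ev x U V).
Proof.
move=> mU mV; apply: measurableI; first exact: measurableX.
rewrite -[X in measurable X]setTI; apply: measurable_addp => //.
exact: measurable_shiftD.
Qed.

Let jt_locmass P Q x : locmass (convp P Q) x = jt P Q x setT setT.
Proof. by rewrite /jt /ev setXTT setTI. Qed.

Let xs_ev x (U V : set R) y : U y -> xsection (ev x U V) y = V `&` shiftD T (x - y).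
Proof.
move=> Uy; apply/seteqP; split => z; rewrite /xsection/= inE.
  by move=> [[_ Vz] /shiftDD].
by move=> [Vz /shiftDD].
Qed.

Let jtC P Q x (U V : set R) : measurable U -> measurable V -> jt P Q x U V = jt Q P x V U.
Proof.
move=> mU mV; rewrite /jt pr_prodC; last exact: mev.
congr (pr _ _); apply/seteqP; split => -[y z]; rewrite /ev /addp/=.
  by move=> [[? ?]]; rewrite addrC.
by move=> [[? ?]]; rewrite addrC.
Qed.

Let jt_ge P Q (x al : R) (U : set R) : measurable U ->
  (forall y, U y -> al <= locmass Q (x - y)) -> al * pr P U <= jt P Q x U setT.
Proof.
move=> mU h; apply: pr_prod_ge => //; first exact: mev.
by move=> y Uy; rewrite xs_ev// setTI; exact: h.
Qed.

Let ev_disj x U V U' V' : ev x U V `&` ev x U' V' `<=` ev x (U `&` U') (V `&` V').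
Proof. by move=> [y z] [[[? ?] ?] [[? ?] ?]]. Qed.

Let le_jt P Q x (U V U' V' : set R) :
  measurable U -> measurable V -> measurable U' -> measurable V' ->
  U `<=` U' -> V `<=` V' -> jt P Q x U V <= jt P Q x U' V'.
Proof.
move=> mU mV mU' mV' UU' VV'; apply: le_pr; [exact: mev|exact: mev|].
by move=> [y z] [[/= /UU' ? /VV' ?] ?].
Qed.

(* For independent Y ~ P and X ~ Q, the events {Y in U} and {X in V} are disjoint
   on {Y + X > x} because U and V lie below A and 2A <= x. *)
Lemma locmass_convp_ge P Q (x A al be : R) (U V : set R) :
  measurable U -> measurable V ->
  (forall y, U y -> y <= A /\ al <= locmass Q (x - y)) ->
  (forall z, V z -> z <= A /\ be <= locmass P (x - z)) ->
  A + A <= x -> al * pr P U + be * pr Q V <= locmass (convp P Q) x.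
Proof.
move=> mU mV hU hV Ax.
have h1 := @jt_ge P Q x al U mU (fun y Uy => (hU y Uy).2).
have h2 := @jt_ge Q P x be V mV (fun y Vy => (hV y Vy).2).
apply: (le_trans (lerD h1 h2)).
rewrite (jtC Q)// -prU; [|exact: mev|exact: mev|].
  rewrite jt_locmass; apply: le_pr; [by apply: measurableU; exact: mev|exact: mev|].
  by move=> z [[_ ?]|[_ ?]].
rewrite disj_set2E; apply/eqP; rewrite -subset0 => -[y z] /ev_disj [[]].
move=> [/= /hU[yA _] _] [_ /hV[zA _]] [+ _].
by rewrite /addp/= ltNge => /negP; apply; apply: le_trans Ax; exact: lerD.
Qed.

(** Given Y = y > A, the conditions X > x - A and y + X <= x + T put X into (x - A) + Delta whatever
    y is, so one bound serves all y. *)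
Let jt_le_tail P Q (x A al : R) : 0 <= al -> locmass Q (x - A) <= al ->
  jt P Q x `]A, +oo[%classic `]x - A, +oo[%classic <= al * pr P `]A, +oo[%classic.
Proof.
move=> al0 hal.
rewrite -(@pr_prodXT _ P Q)//.
apply: (@pr_prod_le _ P Q Q _ _ setT) => //.
- exact: mev.
- exact: measurableX.
- by rewrite setCT measure0.
- move=> y _; have [Ay|Ay] := ltP A y.
    rewrite xs_ev/= ?in_itv/= ?Ay// (_ : xsection _ y = setT); last first.
      apply/seteqP; split => // z _; rewrite /xsection/= inE/=.
      by rewrite in_itv/= Ay.
    rewrite prT mulr1; apply: le_trans hal; apply: le_pr.
    - by apply: measurableI => //; exact: measurable_shiftD.
    - exact: measurable_shiftD.
    move=> z /= []; rewrite in_itv/= andbT => xAz [_ zT]; split => //.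
    apply: le_trans zT _; apply: leeD2r; rewrite lee_fin; lra.
  rewrite (_ : xsection _ y = set0); last first.
    rewrite -subset0 => z; rewrite /xsection/= inE => -[[/=]].
    by rewrite in_itv/= ltNge Ay.
  by rewrite /pr measure0 mulr_ge0// pr_ge0.
Qed.

Let mItv (i : interval R) : measurable [set` i].
Proof. exact: measurable_itv. Qed.

Let jt_le P Q (x al : R) (U W : set R) : measurable U -> measurable W ->
  P (~` W) = 0%E -> 0 <= al ->
  (forall y, W y -> U y -> locmass Q (x - y) <= al) -> jt P Q x U setT <= al * pr P U.
Proof.
move=> mU mW PW al0 h; rewrite -(@pr_prodXT _ P Q)//.
apply: (@pr_prod_le _ P Q Q _ _ W) => //; [exact: mev|exact: measurableX|].
move=> y Wy; have [Uy|nUy] := pselect (U y).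
  rewrite xs_ev// setTI (_ : xsection _ y = setT); last first.
    by apply/seteqP; split => // z _; rewrite /xsection/= inE.
  by rewrite prT mulr1; exact: h.
rewrite (_ : xsection _ y = set0).
  by rewrite /pr measure0 mulr_ge0// pr_ge0.
by rewrite -subset0 => z; rewrite /xsection/= inE => -[[/=]].
Qed.

Let jtU_le P Q x (U U' V V' : set R) :
  measurable U -> measurable V -> measurable U' -> measurable V' ->
  pr (P \x Q)%E (ev x U V `|` ev x U' V') <= jt P Q x U V + jt P Q x U' V'.
Proof. by move=> mU mV mU' mV'; apply: prU_le; exact: mev. Qed.

Let setC_nneg : ~` `[(0 : R), +oo[%classic = `]-oo, 0[%classic.
Proof. by rewrite setCitvr. Qed.

Let pr_halves P (A : R) : pr P `]-oo, A]%classic + pr P `]A, +oo[%classic = 1.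
Proof. by rewrite -[`]-oo, A]%classic]setCitvr prC// subrK. Qed.

(* Four cases for Y ~ P and X ~ G with Y + X in x + Delta: Y <= A; X <= A;
   Y > A and A < X <= x - A, compared through C with two independent copies of G;
   Y > A and X > x - A, which forces X in (x - A) + Delta. *)
Lemma locmass_convp_le P G (x A al al' be C : R) :
  P `]-oo, 0[%classic = 0%E -> G `]-oo, 0[%classic = 0%E ->
  0 <= al -> 0 <= be -> 0 <= C -> 0 <= A -> A + A <= x ->
  (forall y, 0 <= y <= A -> al' <= locmass G (x - y) <= al) ->
  (forall y, 0 <= y <= A -> locmass P (x - y) <= be) ->
  (forall u, A <= u -> locmass P u <= C * locmass G u) ->
  locmass (convp P G) x <=
  al + be + C * (locmass (convp G G) x - 2 * (al' * pr G `[0, A]%classic)).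
Proof.
move=> P0 G0 al0 be0 C0 A0 Ax hG hP hC.
pose U : set R := `]-oo, A]%classic; pose I : set R := `]A, +oo[%classic.
pose K : set R := `]A, (x - A)]%classic.
pose J : set R := `]x - A, +oo[%classic.
have mU : measurable U := mItv _.
have mI : measurable I := mItv _.
have mK : measurable K := mItv _.
have mJ : measurable J := mItv _.
have UI : pr P U + pr P I = 1 := pr_halves P A.
have h1 : jt P G x U setT <= al * pr P U.
  apply: (@jt_le _ _ _ _ _ `[0, +oo[%classic) => //; first by rewrite setC_nneg.
  move=> y; rewrite /U /= !in_itv/= andbT => y0 yA.
  by have /andP[] := hG y (introT andP (conj y0 yA)).
have h2 : jt P G x setT U <= be.
  rewrite jtC//; apply: (@le_trans _ _ (be * pr G U)); last first.
    by rewrite ler_piMr// pr_le1.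
  apply: (@jt_le _ _ _ _ _ `[0, +oo[%classic) => //; first by rewrite setC_nneg.
  move=> y; rewrite /U /= !in_itv/= andbT => y0 yA.
  by apply: hP; rewrite y0.
have h3 : jt P G x I J <= al * pr P I.
  have hA : 0 <= A <= A by rewrite A0 lexx.
  by apply: jt_le_tail => //; have /andP[] := hG A hA.
(* Conditioning on the G-summand y in (A, x - A] leaves a P-mass at x - y >= A, where [hC]
   applies. *)
have h4 : jt P G x I K <= C * jt G G x K setT.
  rewrite jtC//; apply: (@pr_prod_le _ _ _ _ _ _ setT) => //; [exact: mev|exact: mev|..].
    by rewrite setCT measure0.
  move=> y _; have [Ky|nKy] := pselect (K y).
    rewrite !xs_ev// setTI; apply: (@le_trans _ _ (locmass P (x - y))).
      apply: le_pr; [|exact: measurable_shiftD|exact: subIsetr].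
      by apply: measurableI => //; exact: measurable_shiftD.
    by apply: hC; move: Ky; rewrite /K/= in_itv/= => /andP[_]; lra.
  rewrite (_ : xsection _ y = set0).
    by rewrite /pr measure0 mulr_ge0// pr_ge0.
  by rewrite -subset0 => z; rewrite /xsection/= inE => -[[/=]].
(* The events that the first, respectively the second, copy is at most A have mass at least [al' *
   pr G [0, A]] each. They are disjoint as A + A <= x, and [K] is disjoint from both: y <= x - A and
   y + z > x force z > A. *)
have h5 : jt G G x K setT <= locmass (convp G G) x - 2 * (al' * pr G `[0, A]%classic).
  have l1 : al' * pr G `[0, A]%classic <= jt G G x U setT.
    apply: (@le_trans _ _ (jt G G x `[0, A]%classic setT)).
      by apply: jt_ge => // y /= /hG /andP[].
    by apply: le_jt => // y; rewrite /U/= !in_itv/= => /andP[].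
  have l2 : jt G G x U setT = jt G G x setT U by rewrite jtC.
  suff : jt G G x K setT + jt G G x U setT + jt G G x setT U <= locmass (convp G G) x.
    move=> h; rewrite lerBrDr; apply: le_trans h.
    by rewrite -addrA lerD2l mulr_natl mulr2n lerD// -l2.
  rewrite -prU; [|exact: mev|exact: mev|].
    rewrite -prU; [|by apply: measurableU; exact: mev|exact: mev|].
      rewrite jt_locmass; apply: le_pr; [by do 2?apply: measurableU; exact: mev|exact: mev|].
      by move=> z [[[_ ?]|[_ ?]]|[_ ?]].
    rewrite disj_set2E; apply/eqP; rewrite -subset0 => -[y z] /= [[|]].
      rewrite /K /U /ev /addp/= !in_itv/= => -[[/andP[_ yA] _] _] [[_ zA] [xyz _]].
      by have := lerD yA zA; rewrite subrK leNgt xyz.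
    rewrite /K /U /ev /addp/= !in_itv/= => -[[yA _] _] [[_ zA] [xyz _]].
    by have := le_trans (lerD yA zA) Ax; rewrite leNgt xyz.
  rewrite disj_set2E; apply/eqP; rewrite -subset0 => -[y z].
  rewrite /K /U /ev/= !in_itv/= => -[[[/andP[Ay _] _] _] [[yA _] _]].
  by move: yA; rewrite leNgt Ay.
have h6 : locmass (convp P G) x <=
    jt P G x U setT + jt P G x setT U + jt P G x I K + jt P G x I J.
  rewrite jt_locmass.
  apply: (@le_trans _ _ (pr (P \x G)%E
    ((ev x U setT `|` ev x setT U) `|` (ev x I K `|` ev x I J)))).
    apply: le_pr; [exact: mev|by do !apply: measurableU; exact: mev|].
    move=> [y z] [_ yz]; rewrite /= /ev /U /I /K /J /= !in_itv/= !andbT.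
    have [yA|yA] := leP y A; first by left; left.
    have [zA|zA] := leP z A; first by left; right.
    by right; have [zxA|zxA] := leP z (x - A); [left|right]; rewrite ?yA.
  rewrite -addrA; apply: (@le_trans _ _ (pr (P \x G)%E (ev x U setT `|` ev x setT U)
    + pr (P \x G)%E (ev x I K `|` ev x I J))).
    by apply: prU_le; apply: measurableU; exact: mev.
  by apply: lerD; exact: jtU_le.
have h7 : C * jt G G x K setT <=
    C * (locmass (convp G G) x - 2 * (al' * pr G `[0, A]%classic)).
  exact: ler_wpM2l.
have h8 : al * pr P U + al * pr P I = al by rewrite -mulrDr UI mulr1.
apply: (le_trans h6); rewrite -h8.
apply: (le_trans (lerD (lerD (lerD h1 h2) (le_trans h4 h7)) h3)).
by rewrite [leLHS]addrAC (addrAC (al * pr P U) be).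
Qed.

(* Only the part {X1 <= x - A} of the convolution is compared with its translate:
   on {X1 > x - A} either X2 <= A, or X2 > A and X1 lies in (x - A) + Delta. *)
Lemma locmass_convp_shift G (x t A al al' C : R) :
  G `]-oo, 0[%classic = 0%E ->
  0 <= al -> 0 <= C -> 0 <= A -> 0 <= t -> A + A <= x ->
  (forall u, A <= u -> locmass G u <= C * locmass G (u + t)) ->
  (forall z, 0 <= z <= A -> locmass G (x - z) <= al) ->
  (forall z, 0 <= z <= A -> al' <= locmass G (x + t - z)) ->
  locmass (convp G G) x <=
  al + C * (locmass (convp G G) (x + t) - al' * pr G `[0, A]%classic).
Proof.
move=> G0 al0 C0 A0 t0 Ax hC hal hal'.
pose U : set R := `]-oo, A]%classic; pose I : set R := `]A, +oo[%classic.
pose K : set R := `]-oo, (x - A)]%classic.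
pose J : set R := `]x - A, +oo[%classic.
have mU : measurable U := mItv _.
have mI : measurable I := mItv _.
have mK : measurable K := mItv _.
have mJ : measurable J := mItv _.
have UI : pr G U + pr G I = 1 := pr_halves G A.
have h1 : jt G G x setT U <= al * pr G U.
  rewrite jtC//.
  apply: (@jt_le _ _ _ _ _ `[0, +oo[%classic) => //; first by rewrite setC_nneg.
  move=> y; rewrite /U /= !in_itv/= andbT => y0 yA.
  by apply: hal; rewrite y0.
have h2 : jt G G x J I <= al * pr G I.
  by rewrite jtC//; apply: jt_le_tail => //; apply: hal; rewrite A0 lexx.
have h3 : jt G G x K setT <= C * jt G G (x + t) K setT.
  apply: (@pr_prod_le _ _ _ _ _ _ setT) => //; [exact: mev|exact: mev|..].
    by rewrite setCT measure0.
  move=> y _; have [Ky|nKy] := pselect (K y).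
    rewrite !xs_ev// !setTI addrAC; apply: hC.
    by move: Ky; rewrite /K/= in_itv/=; lra.
  rewrite (_ : xsection _ y = set0).
    by rewrite /pr measure0 mulr_ge0// pr_ge0.
  by rewrite -subset0 => z; rewrite /xsection/= inE => -[[/=]].
have h4 : locmass (convp G G) x <= jt G G x K setT + jt G G x setT U + jt G G x J I.
  rewrite jt_locmass.
  apply: (@le_trans _ _ (pr (G \x G)%E
    ((ev x K setT `|` ev x setT U) `|` ev x J I))).
    apply: le_pr; [exact: mev|by do !apply: measurableU; exact: mev|].
    move=> [y z] [_ yz]; rewrite /= /ev /U /I /K /J /= !in_itv/= !andbT.
    have [yA|yA] := leP y (x - A); first by left; left.
    have [zA|zA] := leP z A; first by left; right.
    by right.
  apply: (@le_trans _ _ (pr (G \x G)%E (ev x K setT `|` ev x setT U)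
    + jt G G x J I)).
    by apply: prU_le; [apply: measurableU; exact: mev|exact: mev].
  by rewrite lerD2r; exact: jtU_le.
have h5 : jt G G (x + t) K setT + al' * pr G `[0, A]%classic <= locmass (convp G G) (x + t).
  have l1 : al' * pr G `[0, A]%classic <= jt G G (x + t) setT U.
    rewrite jtC//; apply: (@le_trans _ _ (jt G G (x + t) `[0, A]%classic setT)).
      by apply: jt_ge => // y /= /hal'.
    by apply: le_jt => // y; rewrite /U/= !in_itv/= => /andP[].
  suff : jt G G (x + t) K setT + jt G G (x + t) setT U <= locmass (convp G G) (x + t).
    by apply: le_trans; rewrite lerD2l.
  rewrite -prU; [|exact: mev|exact: mev|].
    rewrite jt_locmass; apply: le_pr; [by do 2?apply: measurableU; exact: mev|exact: mev|].
    by move=> z [[_ ?]|[_ ?]].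
  rewrite disj_set2E; apply/eqP; rewrite -subset0 => -[y z] /=.
  rewrite /K /U /ev /addp/= !in_itv/= => -[[[yA _] _] [[_ zA] [xyz _]]].
  have := lerD yA zA; rewrite subrK leNgt (le_lt_trans _ xyz)//.
  by rewrite lerDl.
have h6 : C * jt G G (x + t) K setT <=
    C * (locmass (convp G G) (x + t) - al' * pr G `[0, A]%classic).
  by apply: ler_wpM2l => //; rewrite lerBrDr.
have h8 : al * pr G U + al * pr G I = al by rewrite -mulrDr UI mulr1.
apply: (le_trans h4); rewrite -h8.
apply: (le_trans (lerD (lerD (le_trans h3 h6) h1) h2)).
by rewrite -addrA addrC.
Qed.

End local_mass.

(** * Exponential moments and compound Poisson laws *)

Section moment_generating.
Context {R : realType}.
Implicit Types P Q : probability R R.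

Lemma convp_nneg P Q : P `]-oo, 0[%classic = 0%E -> Q `]-oo, 0[%classic = 0%E ->
  convp P Q `]-oo, 0[%classic = 0%E.
Proof.
move=> P0 Q0; set A : set R := `]-oo, 0[%classic.
have mA : measurable A by exact: measurable_itv.
have mE : measurable (A `*` [set: R]) by exact: measurableX.
have mE' : measurable ([set: R] `*` A) by exact: measurableX.
have mS : measurable (@addp R @^-1` A).
  by rewrite -[X in measurable X]setTI; exact: measurable_addp.
rewrite prE//; congr EFin; apply/eqP; rewrite eq_le pr_ge0 andbT.
have -> : pr (convp P Q) A = pr (P \x Q)%E (@addp R @^-1` A) by [].
apply: (@le_trans _ _ (pr (P \x Q)%E (A `*` [set: R] `|` [set: R] `*` A))).
  apply: le_pr => //; first exact: measurableU.
  move=> [y z]; rewrite /A /addp/= !in_itv/= => yz.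
  have [?|y0] := ltP y 0; [by left|right; split => //].
  by apply: le_lt_trans yz; rewrite lerDr.
apply: (@le_trans _ _ (pr (P \x Q)%E (A `*` [set: R]) +
  pr (P \x Q)%E ([set: R] `*` A))); first exact: prU_le.
rewrite pr_prodXT// (pr_prodC _ _ _ mE') (_ : _ @^-1` _ = A `*` [set: R]); last first.
  by apply/seteqP; split => -[y z] /= [].
by rewrite pr_prodXT// /pr P0 Q0 addr0.
Qed.

(** One notion for two uses: th = - l <= 0 is the Laplace transform, th = 1 the exponential moment
    that measures how light a law is. *)
Definition mgf (th : R) P : \bar R := (\int[P]_x (expR (th * x))%:E)%E.

Lemma measurable_expRM (th : R) (D : set R) :
  measurable_fun D (fun x : R => (expR (th * x))%:E).
Proof.
apply: measurable_funTS; apply/measurable_EFinP.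
by apply: measurableT_comp => //; exact: mulrl_measurable.
Qed.

Lemma mgf_convp th P Q : mgf th (convp P Q) = (mgf th P * mgf th Q)%E.
Proof.
rewrite /mgf ge0_integral_convp//; last exact: measurable_expRM.
rewrite -ge0_integralZr//; [|exact: measurable_expRM|exact: integral_ge0].
apply: eq_integral => x _.
rewrite -ge0_integralZl//; last exact: measurable_expRM.
by apply: eq_integral => y _; rewrite mulrDr expRD EFinM.
Qed.

Definition dirac_prob (a : R) : probability R R := \d_a.

Lemma mgf_dirac th a : mgf th (dirac_prob a) = (expR (th * a))%:E.
Proof.
rewrite /mgf integral_dirac//; last exact: measurable_expRM.
by rewrite diracT mul1e.
Qed.

Fixpoint convpow P (n : nat) : probability R R :=
  if n is n'.+1 then convp (convpow P n') P else dirac_prob 0.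

Lemma mgf_convpow th P (a : R) n : mgf th P = a%:E ->
  mgf th (convpow P n) = (a ^+ n)%:E.
Proof.
move=> Pa; elim: n => [|n ih] /=; first by rewrite mgf_dirac mulr0 expR0 expr0.
by rewrite mgf_convp ih Pa -EFinM -exprSr.
Qed.

Lemma convpow_nneg P n : P `]-oo, 0[%classic = 0%E ->
  convpow P n `]-oo, 0[%classic = 0%E.
Proof.
move=> P0; elim: n => [|n ih] /=; last exact: convp_nneg.
by rewrite /dirac_prob/= diracE memNset//= in_itv/= ltxx.
Qed.

Definition poisson_weight (w : R) (n : nat) : R := expR (- w) * exp_coeff w n.

Lemma poisson_weight_ge0 (w : R) n : 0 <= w -> 0 <= poisson_weight w n.
Proof. by move=> w0; rewrite mulr_ge0 ?expR_ge0// exp_coeff_ge0. Qed.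

(** The Poisson generating function: a = 1 gives the total mass, a = [mgf th P] the transform of the
    compound law, and a = Kesten's constant a convergent majorant. *)
Lemma nneseries_poisson_weight (w a : R) : 0 <= w -> 0 <= a ->
  (\sum_(n <oo) (poisson_weight w n * a ^+ n)%:E = (expR (w * (a - 1)))%:E)%E.
Proof.
move=> w0 a0.
have e n : (poisson_weight w n * a ^+ n = expR (- w) * exp_coeff (w * a) n)%R.
  by rewrite /poisson_weight /exp_coeff/= exprMn; field; rewrite pnatr_eq0 gtn_eqF// fact_gt0.
under eq_eseriesr do rewrite e EFinM.
rewrite nneseriesZl; last by move=> n _; rewrite lee_fin exp_coeff_ge0// mulr_ge0.
rewrite mulrBr mulr1 expRD (mulrC (expR (w * a))) EFinM; congr (_ * _)%E.
rewrite /expR -EFin_lim; last exact: is_cvg_series_exp_coeff.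
by apply/congr_lim/funext => n/=; rewrite /series/= -sumEFin.
Qed.

Section compound_poisson.
Variables (w : {nonneg R}) (P : probability R R).

Let w0 : 0 <= w%:num. Proof. by []. Qed.

Let pw (n : nat) : {nonneg R} := NngNum (poisson_weight_ge0 _ n w0).

Definition cpoisson : set R -> \bar R :=
  mseries (fun n => mscale (pw n) (convpow P n)) 0.

HB.instance Definition _ := Measure.on cpoisson.

Let cpoisson_setT : cpoisson setT = 1%E.
Proof.
transitivity (expR (w%:num * (1 - 1)))%:E; last by rewrite subrr mulr0 expR0.
rewrite -nneseries_poisson_weight// /cpoisson /mseries/=; apply: eq_eseriesr => n _.
by rewrite /mscale/= probability_setT mule1 expr1n mulr1.
Qed.

HB.instance Definition _ :=
  Measure_isProbability.Build _ _ _ cpoisson cpoisson_setT.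

Lemma cpoissonE B : measurable B ->
  cpoisson B = (\sum_(n <oo) (poisson_weight w%:num n * pr (convpow P n) B)%:E)%E.
Proof.
move=> mB; rewrite /cpoisson /mseries/=; apply: eq_eseriesr => n _.
by rewrite /mscale/= [convpow P n B]prE.
Qed.

Lemma mgf_cpoisson th (a : R) : mgf th P = a%:E ->
  mgf th cpoisson = (expR (w%:num * (a - 1)))%:E.
Proof.
move=> Pa; have a0 : 0 <= a.
  by rewrite -lee_fin -Pa; apply: integral_ge0 => x _; rewrite lee_fin expR_ge0.
rewrite -nneseries_poisson_weight//.
rewrite /mgf /cpoisson ge0_integral_measure_series//=; last exact: measurable_expRM.
apply: eq_eseriesr => n _; rewrite ge0_integral_mscale//=; last exact: measurable_expRM.
by rewrite -/(mgf _ _) (mgf_convpow _ _ _ _ Pa) EFinM.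
Qed.

Lemma cpoisson_nneg : P `]-oo, 0[%classic = 0%E -> cpoisson `]-oo, 0[%classic = 0%E.
Proof.
move=> P0; rewrite cpoissonE//; apply: eseries0 => n _ _.
by rewrite /pr convpow_nneg// mulr0.
Qed.

Lemma pr_cpoisson_ge B N : measurable B ->
  \sum_(n < N) poisson_weight w%:num n * pr (convpow P n) B <= pr cpoisson B.
Proof.
move=> mB; rewrite -lee_fin -prE// [leRHS]cpoissonE// -sumEFin.
rewrite -(big_mkord xpredT (fun n => (poisson_weight w%:num n * pr (convpow P n) B)%:E)).
apply: nneseries_lim_ge => n _ _.
by rewrite lee_fin mulr_ge0 ?poisson_weight_ge0 ?pr_ge0.
Qed.

Lemma pr_cpoisson_le B (K : R) : measurable B ->
  (forall N, \sum_(n < N) poisson_weight w%:num n * pr (convpow P n) B <= K) ->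
  pr cpoisson B <= K.
Proof.
move=> mB h; rewrite -lee_fin -prE// [leLHS]cpoissonE//.
apply: lime_le.
  apply: is_cvg_ereal_nneg_natsum => n _.
  by rewrite lee_fin mulr_ge0 ?poisson_weight_ge0 ?pr_ge0.
by apply: nearW => N; rewrite sumEFin lee_fin big_mkord.
Qed.

End compound_poisson.
End moment_generating.

Section exponential_moment.
Context {R : realType}.
Implicit Types P Q : probability R R.

(** The two terms serve two ranges of the light summand y: [al] where it is small, [be * expR y]
    where it is large. The latter integrates to at most [be * M]. *)
Lemma locmass_convp_le_mgf (T : \bar R) P Q (x al be M : R) :
  P `]-oo, 0[%classic = 0%E -> 0 <= al -> 0 <= be ->
  (forall y, 0 <= y -> locmass T Q (x - y) <= al + be * expR y) ->
  (mgf 1 P <= M%:E)%E -> locmass T (convp P Q) x <= al + be * M.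
Proof.
move=> P0 al0 be0 h PM.
have mS : measurable (@addp R @^-1` shiftD T x).
  rewrite -[X in measurable X]setTI; apply: measurable_addp => //.
  exact: measurable_shiftD.
rewrite -lee_fin -EFin_locmass.
have -> : convp P Q (shiftD T x) =
    (\int[P]_y Q (xsection (@addp R @^-1` shiftD T x) y))%E by [].
apply: (@le_trans _ _ (\int[P]_y (al%:E + be%:E * (expR (1 * y))%:E))%E).
  apply: ae_ge0_le_integral => //.
  - exact: measurable_fun_xsection.
  - by move=> y _; rewrite -EFinM -EFinD lee_fin addr_ge0// mulr_ge0// expR_ge0.
  - apply: emeasurable_funD => //; apply: emeasurable_funM => //.
    exact: measurable_expRM.
  - exists `]-oo, 0[%classic; split => // y /= hy.
    rewrite in_itv/= ltNge; apply/negP => y0; apply: hy => _.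
    have -> : xsection (@addp R @^-1` shiftD T x) y = shiftD T (x - y).
      by apply/seteqP; split => z; rewrite /xsection/= inE/= /addp/= => /shiftDD.
    by rewrite mul1r -EFinM -EFinD EFin_locmass lee_fin; exact: h.
rewrite ge0_integralD//; last 2 first.
- by move=> y _; rewrite -EFinM lee_fin mulr_ge0// expR_ge0.
- by apply: emeasurable_funM => //; exact: measurable_expRM.
rewrite EFinD; apply: leeD.
  rewrite integral_cst// -[leRHS]mule1; apply: lee_pmul => //.
  exact: probability_le1.
rewrite ge0_integralZl//; last exact: measurable_expRM.
by rewrite EFinM; apply: lee_pmul => //; exact: integral_ge0.
Qed.

Lemma pr_le_mgf P (A M : R) : (mgf 1 P <= M%:E)%E ->
  pr P `]A, +oo[%classic <= M * expR (- A).
Proof.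
move=> PM; rewrite expRN ler_pdivlMr ?expR_gt0// mulrC -lee_fin EFinM -prE//.
apply: le_trans PM; rewrite -integral_cst// /mgf.
apply: (@le_trans _ _ (\int[P]_(x in `]A, +oo[%classic) (expR (1 * x))%:E)%E).
  apply: ge0_le_integral => //; [by move=> x _; rewrite lee_fin expR_ge0|exact: measurable_expRM|].
  by move=> x /=; rewrite in_itv/= andbT lee_fin mul1r ler_expR => /ltW.
apply: ge0_subset_integral => //; exact: measurable_expRM.
Qed.

Lemma pr_ge_mgf P (A M : R) : P `]-oo, 0[%classic = 0%E -> (mgf 1 P <= M%:E)%E ->
  0 <= A -> 1 - M * expR (- A) <= pr P `[0, A]%classic.
Proof.
move=> P0 PM A0; rewrite lerBlDr; apply: le_trans (lerD (lexx _) (pr_le_mgf _ A _ PM)).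
rewrite -(@prT _ _ _ P) (_ : setT =
    `]-oo, 0[%classic `|` (`[0, A]%classic `|` `]A, +oo[%classic)); last first.
  apply/seteqP; split => // x _ /=; rewrite !in_itv/= andbT.
  by have [|x0] := ltP x 0; [left|right; have [|] := leP x A; [left|right]].
apply: le_trans (prU_le _ _ _ _ _) _ => //; first exact: measurableU.
by rewrite {1}/pr P0 add0r; exact: prU_le.
Qed.

End exponential_moment.

(** * Convergence of Laplace transforms and of tails *)

Section step_approximation.
Context {R : realType}.

(** For the exponent l x with l = n L / c: compared with n L it is larger by n K at c2 and smaller
    by n K at c1. The midpoint c makes the two margins equal. *)
Lemma midpoint_scale (c1 c2 n L : R) : c1 + c2 != 0 ->
  let c := (c1 + c2) / 2 in let K := (c2 - c1) / (2 * c) * L in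
  (n * L / c * c2 = n * L + n * K) * (n * L / c * c1 = n * L - n * K).
Proof. by move=> c0 /=; split; field. Qed.

Lemma bernoulli_ge (u : R) m : 0 <= u <= 1 -> 1 - m%:R * u <= (1 - u) ^+ m.
Proof.
move=> /andP[u0 u1]; elim: m => [|m ih]; first by rewrite mul0r subr0 expr0.
rewrite exprS -natr1; apply: (@le_trans _ _ ((1 - u) * (1 - m%:R * u))).
  have : 0 <= m%:R * u * u by rewrite !mulr_ge0.
  by lra.
by rewrite ler_wpM2l// subr_ge0.
Qed.

(** By Bernoulli, (1 - u)^m (1 + m u) <= ((1 - u) (1 + u))^m <= 1. *)
Lemma bernoulli_le (u : R) m : 0 <= u <= 1 -> (1 - u) ^+ m * (m%:R * u) <= 1.
Proof.
move=> /andP[u0 u1].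
have h : 1 + m%:R * u <= (1 + u) ^+ m.
  elim: m => [|m ih]; first by rewrite mul0r addr0 expr0.
  rewrite exprS -natr1; apply: (@le_trans _ _ ((1 + u) * (1 + m%:R * u))).
    have : 0 <= m%:R * u * u by rewrite !mulr_ge0.
    by lra.
  by rewrite ler_wpM2l// addr_ge0.
apply: (@le_trans _ _ ((1 - u) ^+ m * (1 + u) ^+ m)).
  rewrite ler_wpM2l ?exprn_ge0 ?subr_ge0//.
  by apply: le_trans h; rewrite lerDr.
rewrite -exprMn exprn_ile1//.
  by rewrite mulr_ge0 ?subr_ge0// addr_ge0.
by have : 0 <= u * u; [rewrite mulr_ge0|lra].
Qed.

(* With u = expR (- (l * x)), l = n ln 2 / c and m = 2 ^ n, the product m * u
   equals 2 ^ (n (1 - x / c)), which tends to 0 for x > c and to +oo for x < c. *)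
Lemma step_approx (c1 c2 eta : R) : 0 <= c1 -> c1 < c2 -> 0 < eta ->
  exists l m, [/\ 0 <= l, forall x, c2 <= x -> 1 - eta <= (1 - expR (- (l * x))) ^+ m &
    forall x, 0 <= x -> x <= c1 -> (1 - expR (- (l * x))) ^+ m <= eta].
Proof.
move=> c10 c12 eta0; pose c := (c1 + c2) / 2.
have cc : 0 < c1 + c2 by rewrite ltr_wpDl// (le_lt_trans c10).
have cn0 := lt0r_neq0 cc.
have c_gt0 : 0 < c by rewrite divr_gt0.
have ln2 : 0 < ln (2 : R) by rewrite ln_gt0// ltr1n.
pose K := (c2 - c1) / (2 * c) * ln 2.
have K0 : 0 < K by rewrite mulr_gt0// divr_gt0 ?subr_gt0// mulr_gt0.
(* Large enough for expR (- (n K)) <= eta, which bounds the error on both sides of the step. *)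
pose n := (Num.truncn (- ln eta / K)).+1.
have hn : expR (- (n%:R * K)) <= eta.
  rewrite -[leRHS]lnK ?posrE// ler_expR lerNl -ler_pdivrMr// ltW//.
  by rewrite truncnS_gt.
have m2 : ((2 ^ n)%N%:R : R) = expR (n%:R * ln 2).
  by rewrite natrX mulrC expRM_natr lnK// posrE.
pose l := n%:R * ln 2 / c.
have l0 : 0 <= l by rewrite /l divr_ge0 ?(ltW c_gt0)// mulr_ge0// ltW.
have u01 x : 0 <= x -> 0 <= expR (- (l * x)) <= 1.
  by move=> x0; rewrite expR_ge0 -expR0 ler_expR oppr_le0 mulr_ge0.
exists l, (2 ^ n)%N; split => // x.
  move=> c2x; have x0 : 0 <= x := le_trans (le_trans c10 (ltW c12)) c2x.
  apply: le_trans (bernoulli_ge _ _ (u01 x x0)); rewrite lerB// m2 -expRD.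
  apply: le_trans hn; rewrite ler_expR.
  have : l * c2 <= l * x by rewrite ler_wpM2l.
  rewrite (midpoint_scale c1 c2 n%:R (ln 2) cn0).1 -/K => hl.
  by rewrite lerBlDr addrC lerBrDr.
move=> x0 xc1.
have h := bernoulli_le (expR (- (l * x))) (2 ^ n) (u01 x x0).
apply: le_trans hn; rewrite expRN -div1r ler_pdivlMr ?expR_gt0//.
apply: le_trans h; rewrite ler_wpM2l//.
  by rewrite exprn_ge0// subr_ge0; have /andP[] := u01 x x0.
rewrite m2 -expRD ler_expR.
have : l * x <= l * c1 by rewrite ler_wpM2l.
rewrite (midpoint_scale c1 c2 n%:R (ln 2) cn0).2 -/K => hl.
by rewrite lerBrDr addrC -lerBrDr.
Qed.

End step_approximation.

Section laplace_continuity.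
Context {R : realType}.
Implicit Types P F : probability R R.

Let D : set R := `[0, +oo[%classic.

(** A polynomial in exponentials that approximates the indicator of a half-line. The factor with
    [l0] is there for [I_rec]: removing one power of 1 - e^{-l x} gives a difference of two
    integrals of the same shape, so convergence follows by induction on m without a binomial
    expansion. *)
Let st (l0 l : R) (m : nat) (x : R) : R :=
  expR (- (l0 * x)) * (1 - expR (- (l * x))) ^+ m.

Let stE l m x : st 0 l m x = (1 - expR (- (l * x))) ^+ m.
Proof. by rewrite /st mul0r oppr0 expR0 mul1r. Qed.

Let st01 l0 l m x : 0 <= l0 -> 0 <= l -> 0 <= x -> 0 <= st l0 l m x <= 1.
Proof.
move=> l00 ll0 x0.
have e01 (k : R) : 0 <= k -> 0 <= expR (- (k * x)) <= 1.
  by move=> k0; rewrite expR_ge0 -expR0 ler_expR oppr_le0 mulr_ge0.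
have /andP[a0 a1] := e01 _ l00; have /andP[b0 b1] := e01 _ ll0.
have c0 : 0 <= 1 - expR (- (l * x)) by rewrite subr_ge0.
have c1 : 1 - expR (- (l * x)) <= 1 by rewrite lerBlDr lerDl.
by rewrite /st mulr_ge0 ?exprn_ge0//= mulr_ile1 ?exprn_ge0// exprn_ile1.
Qed.

Let mst l0 l m : measurable_fun D (st l0 l m).
Proof.
have me (k : R) : measurable_fun D (fun x : R => expR (- (k * x))).
  apply: measurable_funTS; apply: measurableT_comp => //.
  by apply: measurableT_comp => //; exact: mulrl_measurable.
apply: measurable_funM => //; apply: measurable_funX.
by apply: measurable_funB.
Qed.

Let int01 P (f : R -> R) : measurable_fun D f ->
  (forall x, D x -> 0 <= f x <= 1) -> P.-integrable D (EFin \o f).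
Proof.
move=> mf f01; apply: measurable_bounded_integrable => //.
- exact: measurable_itv.
- by rewrite -ge0_fin_numE// fin_num_measure//; exact: measurable_itv.
- exists 1; split => // M M1 x Dx /=.
  have /andP[f0 f1] := f01 _ Dx.
  by rewrite ger0_norm// (le_trans f1)// ltW.
Qed.

Let D0 x : D x -> 0 <= x. Proof. by rewrite /D/= in_itv/= andbT. Qed.

Let ist P l0 l m : 0 <= l0 -> 0 <= l -> P.-integrable D (EFin \o st l0 l m).
Proof.
by move=> l00 ll0; apply: int01 => // x /D0 x0; exact: st01.
Qed.

Let I P l0 l m := \int[P]_(x in D) st l0 l m x.

Let I_rec P l0 l m : 0 <= l0 -> 0 <= l ->
  I P l0 l m.+1 = I P l0 l m - I P (l0 + l) l m.
Proof.
move=> l00 ll0; rewrite /I -RintegralB//; last 3 first.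
- exact: measurable_itv.
- exact: ist.
- by apply: ist => //; exact: addr_ge0.
apply: eq_Rintegral => x _.
by rewrite /st mulrDl opprD expRD exprS; ring.
Qed.

Variables (Ps : nat -> probability R R) (F : probability R R).
Hypothesis lap : forall l, 0 <= l ->
  (\int[Ps k]_(x in D) expR (- (l * x))) @[k --> \oo] -->
  \int[F]_(x in D) expR (- (l * x)).
Hypothesis incr : forall k x, 0 <= x ->
  pr (Ps k) `]x, +oo[%classic <= pr (Ps k.+1) `]x, +oo[%classic.

Let cvg_I l0 l m : 0 <= l0 -> 0 <= l -> I (Ps k) l0 l m @[k --> \oo] --> I F l0 l m.
Proof.
move=> + ll0; elim: m l0 => [|m ih] l0 l00.
  have e P : I P l0 l 0 = \int[P]_(x in D) expR (- (l0 * x)).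
    by apply: eq_Rintegral => x _; rewrite /st expr0 mulr1.
  by rewrite e; under eq_fun do rewrite e; exact: lap.
rewrite I_rec//; under eq_fun do rewrite I_rec//.
by apply: cvgB; apply: ih => //; exact: addr_ge0.
Qed.

Let Rintegral_indic P (B : set R) : measurable B -> B `<=` D ->
  \int[P]_(x in D) \1_B x = pr P B.
Proof.
move=> mB BD; rewrite /Rintegral integral_indic//; last exact: measurable_itv.
by rewrite setIidl.
Qed.

Let sub_D (c : R) : 0 <= c -> `]c, +oo[%classic `<=` D.
Proof.
by move=> c0 x; rewrite /D/= !in_itv/= !andbT => /ltW; exact: le_trans.
Qed.

Let mBi (c : R) : measurable (`]c, +oo[%classic : set R).
Proof. exact: measurable_itv. Qed.

Let int_indic P (c : R) : P.-integrable D (EFin \o (\1_(`]c, +oo[%classic) : R -> R)).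
Proof.
apply: int01; first by apply: measurable_funTS; exact: measurable_indic.
by move=> x _; rewrite indicE; case: (_ \in _); rewrite ?lexx ?ler01.
Qed.

Let le_IntegralD P (f g : R -> R) (eta : R) :
  P.-integrable D (EFin \o f) -> P.-integrable D (EFin \o g) -> 0 <= eta ->
  (forall x, D x -> f x <= g x + eta) ->
  \int[P]_(x in D) f x <= \int[P]_(x in D) g x + eta.
Proof.
move=> fi gi e0 fg; have mD : measurable D by exact: measurable_itv.
have ci : P.-integrable D (EFin \o (cst eta : R -> R)).
  by apply: finite_measure_integrable_cst.
apply: (@le_trans _ _ (\int[P]_(x in D) (g x + cst eta x))).
  apply: le_Rintegral => //.
  apply: (@eq_integrable _ _ _ _ _ mD ((EFin \o g) \+ (EFin \o cst eta))) => //.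
  exact: integrableD.
rewrite RintegralD// lerD2l Rintegral_cst//.
by rewrite ler_piMr// (pr_le1 P).
Qed.

Let I_ge P l m (c2 eta : R) : 0 <= l -> 0 <= c2 -> 0 <= eta ->
  (forall x, c2 <= x -> 1 - eta <= (1 - expR (- (l * x))) ^+ m) ->
  pr P `]c2, +oo[%classic <= I P 0 l m + eta.
Proof.
move=> l0 c20 e0 h.
rewrite -(Rintegral_indic P `]c2, +oo[%classic)//; last exact: sub_D.
apply: le_IntegralD => // [|x /D0 x0]; first exact: ist.
have [xc|xc] := ltP c2 x.
  rewrite indicE mem_set/= ?in_itv/= ?andbT// -lerBlDr stE.
  by apply: h; exact: ltW.
rewrite indicE memNset/= ?in_itv/= ?andbT ?addr_ge0//.
  by have /andP[] := st01 0 l m x (lexx _) l0 x0.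
by apply/negP; rewrite -leNgt.
Qed.

Let I_le P l m (c1 eta : R) : 0 <= l -> 0 <= c1 -> 0 <= eta ->
  (forall x, 0 <= x -> x <= c1 -> (1 - expR (- (l * x))) ^+ m <= eta) ->
  I P 0 l m <= pr P `]c1, +oo[%classic + eta.
Proof.
move=> l0 c10 e0 h.
rewrite -(Rintegral_indic P `]c1, +oo[%classic)//; last exact: sub_D.
apply: le_IntegralD => // [|x /D0 x0]; first exact: ist.
have [xc|xc] := ltP c1 x.
  rewrite indicE mem_set/= ?in_itv/= ?andbT//.
  have /andP[_ s1] := st01 0 l m x (lexx _) l0 x0.
  by apply: le_trans s1 _; rewrite lerDl.
rewrite indicE memNset/= ?in_itv/= ?andbT ?add0r; first by rewrite stE; exact: h.
by apply/negP; rewrite -leNgt.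
Qed.

Let tail_right P (x e : R) : 0 < e -> exists2 c, x < c &
  pr P `]x, +oo[%classic <= pr P `]c, +oo[%classic + e.
Proof.
move=> e0.
pose B n : set R := `]x + n.+1%:R^-1, +oo[%classic.
have mB n : measurable (B n) by exact: measurable_itv.
have UB : \bigcup_n B n = `]x, +oo[%classic.
  apply/seteqP; split => y.
    move=> [n _]; rewrite /B/= !in_itv/= !andbT; apply: lt_trans.
    by rewrite ltrDl invr_gt0.
  rewrite /= in_itv/= andbT => xy; exists (Num.truncn ((y - x)^-1)) => //.
  rewrite /B/= in_itv/= andbT addrC -ltrBrDr.
  by rewrite invf_plt ?posrE ?subr_gt0// truncnS_gt.
have ndB : {homo B : n m / (n <= m)%N >-> (n <= m)%O}.
  move=> n m nm; apply/subsetPset => y; rewrite /B/= !in_itv/= !andbT.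
  by apply: le_lt_trans; rewrite lerD2l lef_pV2 ?posrE// ler_nat.
have : P (B n) @[n --> \oo] --> (pr P `]x, +oo[%classic)%:E.
  rewrite -(prE P _ (mBi x)) -UB; apply: nondecreasing_cvg_mu => //.
  exact: bigcup_measurable.
move=> /fine_cvgP[_] /cvgrPdist_le /(_ e e0)[N _ /(_ N (leqnn N))] hN.
exists (x + N.+1%:R^-1); first by rewrite ltrDl invr_gt0.
by move: hN => /= /ler_normlW; rewrite lerBlDl.
Qed.

Let le_incr x : 0 <= x ->
  {homo (fun k => pr (Ps k) `]x, +oo[%classic) : j k / (j <= k)%N >-> j <= k}.
Proof.
move=> x0; apply: homo_leq => [k|k j i|k]; [exact: lexx|exact: le_trans|].
exact: incr.
Qed.

(** A step rising between c1 and c2 lies, up to e / 2, above the indicator of (c2, oo) and below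
    that of (c1, oo). Its integrals converge, and all laws after the k-th have at least the tail of
    the k-th at c2. *)
Let tail_lt (c1 c2 : R) k : 0 <= c1 -> c1 < c2 ->
  pr (Ps k) `]c2, +oo[%classic <= pr F `]c1, +oo[%classic.
Proof.
move=> c10 c12; apply/ler_addgt0Pr => e e0.
have e20 : 0 < e / 2 by rewrite divr_gt0.
have [l [m [l0 h2 h1]]] := step_approx c1 c2 (e / 2) c10 c12 e20.
have c20 : 0 <= c2 by rewrite (le_trans c10)// ltW.
rewrite [in leRHS](splitr e) addrA.
apply: (@le_trans _ _ (I F 0 l m + e / 2)); last by rewrite lerD2r I_le// ltW.
rewrite -lerBlDr; apply: (cvgr_to_ge (cvg_I 0 l m (lexx _) l0)).
exists k => // j /= kj; rewrite lerBlDr.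
by apply: (le_trans (le_incr c2 c20 _ _ kj)); apply: I_ge => //; exact: ltW.
Qed.

(** Let c2 decrease to x in [tail_lt]; the tail of [Ps k] is right-continuous. *)
Lemma laplace_tail_le k x : 0 <= x ->
  pr (Ps k) `]x, +oo[%classic <= pr F `]x, +oo[%classic.
Proof.
move=> x0; apply/ler_addgt0Pr => e e0.
have [c xc] := tail_right (Ps k) x e e0.
by move=> /le_trans; apply; rewrite lerD2r; exact: tail_lt.
Qed.

Lemma laplace_tail_cvg x : 0 <= x ->
  pr (Ps k) `]x, +oo[%classic @[k --> \oo] --> pr F `]x, +oo[%classic.
Proof.
move=> x0; apply/cvgrPdist_le => e e0.
(* Four errors: right-continuity of the tail of F, the two sides of the step, and the convergence of
   its integrals. *)
have e40 : 0 < e / 4 by rewrite divr_gt0.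
have [c xc hc] := tail_right F x (e / 4) e40.
have [l [m [l0 h2 h1]]] := step_approx x c (e / 4) x0 xc e40.
have /cvgrPdist_le /(_ _ e40) := cvg_I 0 l m (lexx _) l0.
apply: filterS => k /ler_normlW hk.
rewrite ger0_norm ?subr_ge0; last exact: laplace_tail_le.
have := I_le (Ps k) l m x (e / 4) l0 x0 (ltW e40) h1.
have := I_ge F l m c (e / 4) l0 (le_trans x0 (ltW xc)) (ltW e40) h2.
lra.
Qed.

End laplace_continuity.

(** * Decomposition of the Levy measure *)

Lemma mnormalizeE {d} {T : measurableType d} {R : realType}
    (m : {measure set T -> \bar R}) (p : probability T R) (c : \bar R) B :
  m setT = c -> c != 0%E -> c != +oo%E ->
  mnormalize m p B = (m B * ((fine c)^-1)%:E)%E.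
Proof. by move=> <- /negbTE c0 /negbTE cy; rewrite /mnormalize /= c0 cy. Qed.

Section restriction.
Context {R : realType} (nu : {measure set R -> \bar R}).

Definition restricts (S : set R) (w : {nonneg R}) (P : probability R R) :=
  forall B, measurable B -> nu (B `&` S) = (w%:num * pr P B)%:E.

(** If nu S = 0, [restricts] does not determine the law; the unit mass at 0 is chosen, hence the
    proviso [~ B 0]. The second clause serves to locate the support of P. *)
Lemma restricts_ex (S : set R) : measurable S -> S `<=` `]0, +oo[%classic ->
  (nu S < +oo)%E ->
  exists w P, restricts S w P /\
    forall B, measurable B -> B `&` S = set0 -> ~ B 0 -> P B = 0%E.
Proof.
move=> mS S0 Sfin.
have Sfn : nu S \is a fin_num by rewrite ge0_fin_numE.
have [nuS0|nuS0] := eqVneq (nu S) 0%E.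
  exists 0%:nng, (dirac_prob 0); split.
    move=> B mB /=; rewrite mul0r; apply/eqP; rewrite eq_le measure_ge0 andbT.
    apply: (@le_trans _ _ (nu S)); last by rewrite nuS0.
    by rewrite le_measure ?inE//; exact: measurableI.
  by move=> B _ _ B0; rewrite /dirac_prob/= diracE memNset.
have mu_gt0 : 0 < fine (nu S) by rewrite fine_gt0// lt0e nuS0 measure_ge0.
pose m := mrestr nu mS.
have mE B : mnormalize m (dirac_prob 0) B = (nu (B `&` S) * ((fine (nu S))^-1)%:E)%E.
  apply: (mnormalizeE m (dirac_prob 0) (nu S)) => //; last by rewrite lt_eqF.
  exact: (congr1 nu (setTI S)).
exists (NngNum (ltW mu_gt0)), (mnormalize m (dirac_prob 0)); split.
  move=> B mB /=.
  have -> : pr (mnormalize m (dirac_prob 0)) B = _ := congr1 fine (mE B).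
  have Bfin : nu (B `&` S) \is a fin_num.
    rewrite ge0_fin_numE//; apply: le_lt_trans Sfin.
    by rewrite le_measure ?inE//; exact: measurableI.
  by rewrite fineM// mulrC -mulrA mulVf ?gt_eqF// mulr1 fineK.
by move=> B mB BS _; apply: etrans (mE B) _; rewrite BS measure0 mul0e.
Qed.

Lemma restricts_integral S w P (f : R -> \bar R) : restricts S w P ->
  measurable S -> measurable_fun setT f -> (forall x, 0 <= f x)%E ->
  (\int[nu]_(x in S) f x = w%:num%:E * \int[P]_x f x)%E.
Proof.
move=> hP mS mf f0.
rewrite (@eq_measure_integral _ _ _ _ (mscale w P)); last first.
  move=> A mA AS; rewrite -{1}(setIidl AS) hP//.
  by rewrite EFinM -prE.
rewrite ge0_integral_mscale//; last exact: measurable_funTS.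
have [->|w0] := eqVneq w%:num 0; first by rewrite !mul0e.
congr (_ * _)%E; rewrite [RHS](@ge0_negligible_integral _ _ _ _ _ (~` S))//.
- by rewrite setTD setCK.
- exact: measurableC.
- apply: etrans (prE P _ (measurableC mS)) _.
  have := hP (~` S) (measurableC mS); rewrite setICl measure0 => /esym/eqP.
  by rewrite eqe mulf_eq0 (negbTE w0)/= => /eqP ->.
Qed.

End restriction.

Section levy_piece.
Context {R : realType} (nu : {measure set R -> \bar R}).
Variables (S : set R) (w : {nonneg R}) (P : probability R R).
Hypotheses (hP : restricts nu S w P) (mS : measurable S)
  (S0 : S `<=` `]0, +oo[%classic).

Lemma mgf_le (Q : probability R R) (W : set R) (th K : R) :
  measurable W -> Q (~` W) = 0%E -> 0 <= K ->
  (forall x, W x -> expR (th * x) <= K) -> (mgf th Q <= K%:E)%E.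
Proof.
move=> mW QW K0 h; apply: (@le_trans _ _ (\int[Q]_x (cst K%:E) x)%E).
  apply: ae_ge0_le_integral => //; first exact: measurable_expRM.
  exists (~` W); split => //; first exact: measurableC.
  by move=> x /= hx Wx; apply: hx => _; rewrite lee_fin h.
rewrite integral_cst// -[leRHS]mule1; apply: lee_pmul => //.
exact: probability_le1.
Qed.

Lemma mgf_fin (Q : probability R R) (th K : R) : (mgf th Q <= K%:E)%E ->
  exists2 b : R, 0 <= b & mgf th Q = b%:E.
Proof.
move=> h; have m0 : (0 <= mgf th Q)%E by apply: integral_ge0.
exists (fine (mgf th Q)); first by rewrite fine_ge0.
by rewrite fineK// ge0_fin_numE// (le_lt_trans h)// ltry.
Qed.

Let S_expR th (b : R) : mgf th P = b%:E ->
  (\int[nu]_(x in S) (expR (th * x))%:E = (w%:num * b)%:E)%E.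
Proof.
move=> Pb; rewrite (restricts_integral _ _ _ _ _ hP)//; first by rewrite -/(mgf _ _) Pb.
exact: measurable_expRM.
Qed.

Let S_1 : (\int[nu]_(x in S) 1 = (w%:num)%:E)%E.
Proof.
by rewrite integral_cst// mul1e -(setTI S) hP// prT mulr1.
Qed.

Lemma levy_piece_laplace l : 0 <= l -> P `]-oo, 0[%classic = 0%E ->
  exists ph : R, [/\ 0 <= ph,
   (\int[nu]_(x in S) (1 - expR (- (l * x)))%:E = ph%:E)%E &
   mgf (- l) (cpoisson w P) = (expR (- ph))%:E].
Proof.
move=> l0 P0.
have [b b0 Pb] : exists2 b : R, 0 <= b & mgf (- l) P = b%:E.
  apply: (@mgf_fin _ _ 1); apply: (@mgf_le _ `[0, +oo[%classic) => //.
    by rewrite setCitvr.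
  move=> x /=; rewrite in_itv/= andbT => x0.
  by rewrite -expR0 ler_expR mulNr oppr_le0 mulr_ge0.
set X := (\int[nu]_(x in S) (1 - expR (- (l * x)))%:E)%E.
have i0 x : S x -> (0 <= (1 - expR (- (l * x)))%:E)%E.
  move=> /S0/=; rewrite in_itv/= andbT => x0.
  by rewrite lee_fin subr_ge0 -expR0 ler_expR oppr_le0 mulr_ge0// ltW.
have X0 : (0 <= X)%E by exact: integral_ge0.
(* The additive form comes first: it shows that X is finite, and only then can one subtract. *)
have XE : (X + (w%:num * b)%:E = (w%:num)%:E)%E.
  rewrite -(S_expR _ _ Pb) -S_1 -ge0_integralD//; last 2 first.
  - apply: measurable_funTS; apply/measurable_EFinP; apply: measurable_funB => //.
    by apply: measurableT_comp => //; apply: measurableT_comp => //; exact: mulrl_measurable.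
  - exact: measurable_expRM.
  by apply: eq_integral => x _; rewrite -EFinD mulNr subrK.
have {}XE : X = (w%:num * (1 - b))%:E.
  case: X X0 XE => [r _||//]; last by [].
  by move=> [h]; congr EFin; rewrite mulrBr mulr1 -[X in _ = X - _]h addrK.
exists (w%:num * (1 - b)); split => //; first by rewrite -lee_fin -XE.
by rewrite (mgf_cpoisson _ _ _ _ Pb) -mulrN opprB.
Qed.

(** On (0, 1] one has e^x - 1 <= x e^x <= e x, so the exponent w (b - 1) is at most e times the
    integral of x over the piece. These integrals have a finite sum over the pieces, which makes the
    moment bound uniform. *)
Lemma levy_piece_exp (io : R) : S `<=` `]-oo, 1]%classic -> P `]-oo, 0[%classic = 0%E ->
  P `]1, +oo[%classic = 0%E -> (\int[nu]_(x in S) x%:E = io%:E)%E ->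
  (mgf 1 (cpoisson w P) <= (expR (expR 1 * io))%:E)%E.
Proof.
move=> S1 P0 P1 Sio.
have [b b0 Pb] : exists2 b : R, 0 <= b & mgf 1 P = b%:E.
  apply: (@mgf_fin _ _ (expR 1)); apply: (@mgf_le _ `]-oo, 1]%classic) => //.
    by rewrite setCitvl.
  by move=> x /=; rewrite in_itv/= mul1r ler_expR.
rewrite (mgf_cpoisson _ _ _ _ Pb) lee_fin ler_expR mulrBr mulr1 lerBlDl.
rewrite -lee_fin -(S_expR _ _ Pb) EFinD EFinM -S_1 -Sio.
have S0' x : S x -> 0 <= x by move=> /S0/=; rewrite in_itv/= andbT => /ltW.
have mid : measurable_fun S (fun x : R => x%:E) by apply/measurable_EFinP.
rewrite -ge0_integralZl//.
rewrite -ge0_integralD//; last 2 first.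
- by move=> x /S0' x0; rewrite mule_ge0// lee_fin// expR_ge0.
- exact: emeasurable_funM.
apply: ge0_le_integral => //.
- exact: measurable_expRM.
- by apply: emeasurable_funD => //; exact: emeasurable_funM.
move=> x Sx; rewrite -EFinM -EFinD lee_fin mul1r.
have x0 := S0' _ Sx; have x1 : x <= 1 by have := S1 _ Sx; rewrite /= in_itv.
apply: (@le_trans _ _ (1 + expR x * x)); last first.
  by rewrite lerD2l ler_wpM2r// ler_expR.
have := ler_wpM2l (expR_ge0 x) (expR_ge1Dx (- x)).
by rewrite expRxMexpNx_1 mulrDr mulr1 mulrN lerBlDr.
Qed.

End levy_piece.

Section convolution_tails.
Context {R : realType}.
Implicit Types P Q : probability R R.

Let mpre (B : set R) : measurable B -> measurable (@addp R @^-1` B).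
Proof.
by move=> mB; rewrite -[X in measurable X]setTI; exact: measurable_addp.
Qed.

Lemma pr_convpC P Q (B : set R) : measurable B ->
  pr (convp P Q) B = pr (convp Q P) B.
Proof.
move=> mB; have e := pr_prodC P Q (@addp R @^-1` B) (mpre _ mB).
apply: etrans e _; congr (pr _ _).
by apply/seteqP; split => -[y z]; rewrite /addp/= addrC.
Qed.

Let xs_tail (x y : R) :
  xsection (@addp R @^-1` `]x, +oo[%classic) y = `]x - y, +oo[%classic.
Proof.
apply/seteqP; split => z; rewrite /xsection/= inE/= /addp/= !in_itv/= !andbT.
  by rewrite ltrBlDl.
by rewrite ltrBlDl.
Qed.

Lemma tail_convp_mono P Q Q' (x : R) :
  (forall y, pr Q `]y, +oo[%classic <= pr Q' `]y, +oo[%classic) ->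
  pr (convp Q P) `]x, +oo[%classic <= pr (convp Q' P) `]x, +oo[%classic.
Proof.
move=> h; rewrite !(pr_convpC _ P)//.
rewrite -[leRHS]mul1r.
apply: (@pr_prod_le _ P Q Q' (@addp R @^-1` _) (@addp R @^-1` _) setT) => //.
- exact: mpre.
- exact: mpre.
- by rewrite setCT measure0.
- by move=> y _; rewrite !xs_tail mul1r; exact: h.
Qed.

Lemma tail_convp_ge P Q (x : R) : P `]-oo, 0[%classic = 0%E ->
  pr Q `]x, +oo[%classic <= pr (convp P Q) `]x, +oo[%classic.
Proof.
move=> P0.
have P1 : pr P `[0, +oo[%classic = 1.
  have := prC P `]-oo, 0[%classic; rewrite /pr P0 subr0 setCitvl; apply.
  exact: measurable_itv.
rewrite -[leLHS]mulr1 -P1.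
apply: (@pr_prod_ge _ P Q (@addp R @^-1` _)) => //; first exact: mpre.
move=> y /=; rewrite in_itv/= andbT => y0; rewrite xs_tail; apply: le_pr => //.
by move=> z /=; rewrite !in_itv/= !andbT; apply: le_lt_trans; rewrite gerBl.
Qed.

Lemma Rintegral_mgf P (l : R) : P `]-oo, 0[%classic = 0%E ->
  \int[P]_(x in `[0, +oo[%classic) expR (- (l * x)) = fine (mgf (- l) P).
Proof.
move=> P0; rewrite /Rintegral; congr fine.
have mN : measurable (`]-oo, 0[%classic : set R) by exact: measurable_itv.
have e0 (x : R) : setT x -> (0 <= (expR (- l * x))%:E)%E.
  by rewrite lee_fin expR_ge0.
have := ge0_negligible_integral mN measurableT (measurable_expRM (- l) setT) e0 P0.
rewrite -/(mgf _ _) => ->; rewrite setTD setCitvl; apply: eq_integral => x _.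
by rewrite mulNr.
Qed.

End convolution_tails.

(** * Approximation of F by laws with finitely many pieces of small jumps *)

Section levy_approximation.
Context {R : realType}.
Variables (F : probability R R) (a : R) (nu : {measure set R -> \bar R}).
Variables (w : {nonneg R}) (P : probability R R).
Hypotheses (a0 : 0 <= a)
  (nuI : (\int[nu]_(x in (`]0%R, 1%R])%classic) x%:E < +oo)%E)
  (lapF : forall l : R, 0 <= l ->
     (\int[F]_(x in (`[0%R, +oo[)%classic) (expR (- (l * x))%R)%:E)%E =
     expeR ((- (a * l))%:E
            - \int[nu]_(x in (`]0%R, +oo[)%classic) (1 - expR (- (l * x)))%R%:E)%E)
  (hP : restricts nu `]1, +oo[%classic w P) (P0 : P `]-oo, 0[%classic = 0%E).

Let S (k : nat) : set R := `]k.+2%:R^-1, k.+1%:R^-1]%classic.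

Let mS k : measurable (S k). Proof. exact: measurable_itv. Qed.

Let S0 k : S k `<=` `]0, +oo[%classic.
Proof.
move=> x; rewrite /S/= !in_itv/= andbT => /andP[+ _].
by apply: lt_trans; rewrite invr_gt0.
Qed.

Let S1 k : S k `<=` `]-oo, 1]%classic.
Proof.
move=> x; rewrite /S/= !in_itv/= => /andP[_ /le_trans]; apply.
by rewrite invf_le1// ler1n.
Qed.

Let bigcupS : \bigcup_k S k = `]0, 1]%classic.
Proof.
apply/seteqP; split => x.
  by move=> [k _ Sx]; move: (S0 k x Sx) (S1 k x Sx); rewrite /= !in_itv/= andbT => ->.
rewrite /= in_itv/= => /andP[x0 x1].
have xV : 1 <= x^-1 by rewrite invf_ge1.
have xV0 : 0 <= x^-1 by rewrite invr_ge0 ltW.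
have [n hn] : exists n, Num.truncn x^-1 = n.+1.
  have : (0 < Num.truncn x^-1)%N by rewrite truncn_gt0.
  by case: (Num.truncn _) => // n _; exists n.
have /andP[h1 h2] := truncn_itv xV0.
exists n => //; rewrite /S/= in_itv/=; rewrite hn in h1 h2; apply/andP; split.
  by rewrite invf_plt ?posrE.
by rewrite -[leLHS]invrK lef_pV2 ?posrE ?invr_gt0.
Qed.

Let trivS : trivIset setT S.
Proof.
apply: ltn_trivIset => n m nm; rewrite -subset0 => x [].
rewrite /S/= !in_itv/= => /andP[h1 _] /andP[_ h2].
have := lt_le_trans h1 h2.
by rewrite ltf_pV2 ?posrE// ltr_nat ltnS ltnNge (leq_trans nm).
Qed.

Let id_ge0 (A : set R) : A `<=` `]0, +oo[%classic -> forall x, A x -> (0 <= x%:E)%E.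
Proof. by move=> A0 x /A0/=; rewrite in_itv/= andbT lee_fin => /ltW. Qed.

Let mid (A : set R) : measurable_fun A (fun x : R => x%:E).
Proof. exact/measurable_EFinP. Qed.

Let nuI_sum : (\int[nu]_(x in (`]0%R, 1%R])%classic) x%:E =
  \sum_(k <oo) \int[nu]_(x in S k) x%:E)%E.
Proof.
rewrite -bigcupS ge0_integral_bigcup//.
by move=> x [k _]; apply: id_ge0; exact: S0.
Qed.

Let nuS_lty k : (\int[nu]_(x in S k) x%:E < +oo)%E.
Proof.
apply: le_lt_trans nuI; rewrite -bigcupS; apply: ge0_subset_integral => //.
- exact: bigcup_measurable.
- by move=> x [j _]; apply: id_ge0; exact: S0.
- exact: bigcup_sup.
Qed.

Let nuS_fin k : (nu (S k) < +oo)%E.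
Proof.
have h : ((k.+2%:R^-1)%:E * nu (S k) <= \int[nu]_(x in S k) x%:E)%E.
  rewrite -integral_cst//; apply: ge0_le_integral => //.
  - by move=> x _; rewrite lee_fin invr_ge0.
  - by move=> x; rewrite /S/= in_itv/= lee_fin => /andP[/ltW].
rewrite ltey; apply/eqP => nuy.
by have := le_lt_trans h (nuS_lty k); rewrite nuy gt0_muley ?ltxx// lte_fin invr_gt0.
Qed.

Let pieces : exists wP : nat -> {nonneg R} * probability R R,
  forall k, [/\ restricts nu (S k) (wP k).1 (wP k).2,
    (wP k).2 `]-oo, 0[%classic = 0%E & (wP k).2 `]1, +oo[%classic = 0%E].
Proof.
have h k : exists wP : {nonneg R} * probability R R,
    [/\ restricts nu (S k) wP.1 wP.2,
     wP.2 `]-oo, 0[%classic = 0%E & wP.2 `]1, +oo[%classic = 0%E].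
  have [u [Q [hQ Q0]]] := restricts_ex nu (S k) (mS k) (S0 k) (nuS_fin k).
  exists (u, Q); split => //; apply: Q0 => //=.
  - rewrite -subset0 => x [/= + /S0/=]; rewrite !in_itv/= andbT => x0 /(lt_trans x0).
    by rewrite ltxx.
  - by rewrite in_itv/= ltxx.
  - rewrite -subset0 => x [/= + /S1/=]; rewrite !in_itv/= andbT => x0 /(lt_le_trans x0).
    by rewrite ltxx.
  - by rewrite in_itv/= andbT ltNge ler01.
by have [f hf] := choice h; exists f.
Qed.

Let ph (l : R) (A : set R) : R := fine (\int[nu]_(x in A) (1 - expR (- (l * x)))%:E)%E.

Let me1 (l : R) (A : set R) : measurable_fun A (fun x : R => (1 - expR (- (l * x)))%:E).
Proof.
apply: measurable_funTS; apply/measurable_EFinP; apply: measurable_funB => //.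
by apply: measurableT_comp => //; apply: measurableT_comp => //; exact: mulrl_measurable.
Qed.

Let e1_ge0 l (A : set R) : 0 <= l -> A `<=` `]0, +oo[%classic ->
  forall x, A x -> (0 <= (1 - expR (- (l * x)))%:E)%E.
Proof.
move=> l0 A0 x /A0/=; rewrite in_itv/= andbT => x0.
by rewrite lee_fin subr_ge0 -expR0 ler_expR oppr_le0 mulr_ge0// ltW.
Qed.

Let ph01_fin l : 0 <= l ->
  (\int[nu]_(x in `]0%R, 1%R]%classic) (1 - expR (- (l * x)))%:E)%E \is a fin_num.
Proof.
move=> l0; have sub : `]0%R, 1%R]%classic `<=` (`]0, +oo[%classic : set R).
  by move=> x /=; rewrite !in_itv/= andbT => /andP[].
rewrite ge0_fin_numE; last by apply: integral_ge0; exact: e1_ge0.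
apply: (@le_lt_trans _ _ (l%:E * \int[nu]_(x in `]0%R, 1%R]%classic) x%:E)%E).
  rewrite -ge0_integralZl//; last exact: id_ge0.
  apply: ge0_le_integral => //.
  - exact: e1_ge0.
  - by apply: emeasurable_funM => //; exact: mid.
  - move=> x _; rewrite -EFinM lee_fin lerBlDr -lerBlDl.
    by have := expR_ge1Dx (- (l * x)).
by rewrite lte_mul_pinfty// lee_fin.
Qed.

Let sum_ph l : 0 <= l ->
  (fun k => \sum_(j < k) ph l (S j)) @ \oo --> ph l `]0, 1]%classic.
Proof.
move=> l0; have fin k : (\int[nu]_(x in S k) (1 - expR (- (l * x)))%:E)%E = (ph l (S k))%:E.
  rewrite fineK// ge0_fin_numE; last by apply: integral_ge0; exact: e1_ge0.
  have := ph01_fin _ l0; rewrite ge0_fin_numE; last first.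
    by apply: integral_ge0; apply: e1_ge0 => // x /=; rewrite !in_itv/= andbT => /andP[].
  apply: le_lt_trans; rewrite -bigcupS; apply: ge0_subset_integral => //.
  - exact: bigcup_measurable.
  - by move=> x [j _]; apply: e1_ge0.
  - exact: bigcup_sup.
have tot : (\sum_(k <oo) (ph l (S k))%:E = (ph l `]0%R, 1%R]%classic)%:E)%E.
  rewrite [RHS]fineK; last exact: ph01_fin.
  rewrite -bigcupS ge0_integral_bigcup//; last by move=> x [j _]; apply: e1_ge0.
  by apply: eq_eseriesr => k _; rewrite fin.
have c : (fun k => \sum_(0 <= j < k) (ph l (S j))%:E)%E @ \oo -->
    (ph l `]0%R, 1%R]%classic)%:E.
  rewrite -tot; apply: is_cvg_nneseries => k _ _.
  by rewrite -fin; apply: integral_ge0; exact: e1_ge0.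
have -> : (fun k => \sum_(j < k) ph l (S j)) =
    (fun k => fine (\sum_(0 <= j < k) (ph l (S j))%:E)%E).
  by apply/funext => k; rewrite sumEFin big_mkord.
exact: fine_cvg c.
Qed.

Let io (A : set R) : R := fine (\int[nu]_(x in A) x%:E)%E.

Let io_fin k : (\int[nu]_(x in S k) x%:E)%E = (io (S k))%:E.
Proof.
by rewrite fineK// ge0_fin_numE; [exact: nuS_lty|apply: integral_ge0; exact: id_ge0].
Qed.

Let sum_io k : \sum_(j < k) io (S j) <= io `]0, 1]%classic.
Proof.
rewrite -lee_fin [leRHS]fineK; last first.
  rewrite ge0_fin_numE//; apply: integral_ge0; apply: id_ge0 => x /=.
  by rewrite !in_itv/= andbT => /andP[].
rewrite nuI_sum -sumEFin -(big_mkord xpredT (fun j => (io (S j))%:E)).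
under eq_bigr do rewrite -io_fin.
by apply: nneseries_lim_ge => j _ _; apply: integral_ge0; exact: id_ge0.
Qed.

(** The new piece is the left factor, the form in which [tail_convp_ge] yields monotonicity in k. *)
Fixpoint levy_partial (wP : nat -> {nonneg R} * probability R R) (k : nat) :
    probability R R :=
  if k is k'.+1 then convp (cpoisson (wP k').1 (wP k').2) (levy_partial wP k')
  else dirac_prob a.

(** Convergence is proved for tails, which increase with k; a local mass inherits it as a difference
    of two tails. *)
Lemma locmass_tails (T : \bar R) (Q : probability R R) (x : R) : (0 < T)%E ->
  locmass T Q x = pr Q `]x, +oo[%classic -
    (if T is r%:E then pr Q `]x + r, +oo[%classic else 0).
Proof.
case: T => [r||//] r0; last first.
  rewrite subr0; congr pr; apply/seteqP; split => y; rewrite /shiftD/= in_itv/= andbT.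
    by case.
  by move=> xy; rewrite addey// leey.
rewrite lte_fin in r0; apply/eqP; rewrite eq_sym subr_eq -prU//; last 2 first.
- exact: measurable_shiftD.
- rewrite disj_set2E; apply/eqP; rewrite -subset0 => y [[_]].
  by rewrite -EFinD lee_fin /= in_itv/= andbT ltNge => ->.
apply/eqP; congr pr; apply/seteqP; split => y; rewrite /shiftD/= !in_itv/= !andbT -EFinD lee_fin.
  by move=> xy; have [|] := leP y (x + r); [left|right].
by move=> [[]//|]; apply: lt_trans; rewrite ltrDl.
Qed.

(* The tails of H k * CP increase with k, as each step adds a nonnegative summand;
   this makes the convergence hold at every point and not only at continuity points. *)
Lemma levy_approx : exists (H : nat -> probability R R) (M : R),
  [/\ forall k, H k `]-oo, 0[%classic = 0%E,
      forall k, (mgf 1 (H k) <= M%:E)%E &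
      forall (T : \bar R) x, (0 < T)%E -> 0 <= x ->
        locmass T (convp (H k) (cpoisson w P)) x @[k --> \oo] --> locmass T F x].
Proof.
have [wP hwP] := pieces; pose H := levy_partial wP.
pose C : probability R R := cpoisson w P.
have C0 : C `]-oo, 0[%classic = 0%E by exact: cpoisson_nneg.
have Q0 k : cpoisson (wP k).1 (wP k).2 `]-oo, 0[%classic = 0%E.
  by have [_ p0 _] := hwP k; exact: cpoisson_nneg.
have H0 k : H k `]-oo, 0[%classic = 0%E.
  rewrite /H; elim: k => [|k ih] /=; last exact: (convp_nneg _ _ (Q0 k) ih).
  by rewrite /dirac_prob/= diracE memNset//= in_itv/= ltNge a0.
(* The shift by a contributes e^a, the j-th piece at most the exponential of e times [io (S j)]. *)
exists H, (expR (a + expR 1 * io `]0, 1]%classic)); split => //.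
  move=> k; apply: (@le_trans _ _ (expR (a + expR 1 * \sum_(j < k) io (S j)))%:E).
    rewrite /H; elim: k => [|k ih] /=.
      by rewrite mgf_dirac big_ord0 mulr0 addr0 mul1r.
    rewrite mgf_convp big_ord_recr/= mulrDr addrA expRD EFinM muleC.
    apply: lee_pmul => //; try exact: integral_ge0.
    have [hk pk0 pk1] := hwP k.
    exact: (levy_piece_exp nu (S k) _ _ hk (mS k) (S0 k) _ (S1 k) pk0 pk1 (io_fin k)).
  by rewrite lee_fin ler_expR lerD2l ler_wpM2l ?expR_ge0.
pose Fk k := convp (H k) C.
have Fk0 k : Fk k `]-oo, 0[%classic = 0%E by exact: convp_nneg.
have S1y : `]1, +oo[%classic `<=` (`]0, +oo[%classic : set R).
  by move=> x /=; rewrite !in_itv/= !andbT; apply: lt_trans.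
have mgfF k l : 0 <= l -> mgf (- l) (Fk k) =
    (expR (- (a * l) - (\sum_(j < k) ph l (S j) + ph l `]1, +oo[%classic)))%:E.
  move=> l0; have [b [b0 hb hb']] := levy_piece_laplace nu _ _ _ hP (measurable_itv _) S1y l l0 P0.
  rewrite /Fk mgf_convp hb'.
  have -> : ph l `]1, +oo[%classic = b by rewrite /ph hb.
  rewrite opprD addrA expRD EFinM; congr (_ * _)%E.
  rewrite /H; elim: k => [|k ih] /=; first by rewrite mgf_dirac big_ord0 subr0 mulNr mulrC.
  have [hk pk0 pk1] := hwP k.
  have [c [c0 hc hc']] := levy_piece_laplace nu _ _ _ hk (mS k) (S0 k) l l0 pk0.
  rewrite mgf_convp hc' ih big_ord_recr/=.
  have -> : ph l (S k) = c by rewrite /ph hc.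
  by rewrite -EFinM -expRD; congr (expR _)%:E; ring.
have lap l : 0 <= l -> (\int[Fk k]_(x in `[0, +oo[%classic) expR (- (l * x))) @[k --> \oo] -->
    \int[F]_(x in `[0, +oo[%classic) expR (- (l * x)).
  move=> l0.
  have -> : \int[F]_(x in `[0, +oo[%classic) expR (- (l * x)) =
      expR (- (a * l) - (ph l `]0, 1]%classic + ph l `]1, +oo[%classic)).
    have [b [b0 hb hb']] := levy_piece_laplace nu _ _ _ hP (measurable_itv _) S1y l l0 P0.
    rewrite /Rintegral lapF//.
    have -> : (`]0, +oo[%classic : set R) = `]0, 1]%classic `|` `]1, +oo[%classic.
      apply/seteqP; split => x /=; rewrite !in_itv/= !andbT.
        by move=> x0; have [|] := leP x 1; [left; rewrite x0|right].
      by move=> [/andP[]//|]; apply: lt_trans.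
    have s01 : `]0%R, 1%R]%classic `<=` (`]0, +oo[%classic : set R).
      by move=> x /=; rewrite !in_itv/= andbT => /andP[].
    rewrite ge0_integral_setU//; last 2 first.
    - by move=> x [/s01|/S1y]; apply: e1_ge0.
    - rewrite disj_set2E; apply/eqP; rewrite -subset0 => x [] /=.
      by rewrite !in_itv/= andbT => /andP[_]; rewrite leNgt => /negP.
    rewrite hb -[X in (_ - (X + _))%E](fineK (ph01_fin _ l0)) -/(ph _ _).
    by have -> : ph l `]1, +oo[%classic = b by rewrite /ph hb.
  under eq_fun do rewrite Rintegral_mgf// mgfF//=.
  apply: continuous_cvg; first exact: continuous_expR.
  apply: cvgB; first exact: cvg_cst.
  by apply: cvgD; [exact: sum_ph|exact: cvg_cst].
have incr k x : 0 <= x -> pr (Fk k) `]x, +oo[%classic <= pr (Fk k.+1) `]x, +oo[%classic.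
  move=> _; apply: tail_convp_mono => y.
  exact: (tail_convp_ge _ (H k) y (Q0 k)).
have cvgt x : 0 <= x -> pr (Fk k) `]x, +oo[%classic @[k --> \oo] --> pr F `]x, +oo[%classic.
  exact: laplace_tail_cvg.
move=> T x T0 x0; rewrite locmass_tails//; under eq_fun do rewrite locmass_tails//.
apply: cvgB; first exact: cvgt.
case: T T0 => [r r0|_|//]; last exact: cvg_cst.
by apply: cvgt; rewrite addr_ge0// ltW.
Qed.

End levy_approximation.

(** * Long tails and convolution powers *)

Section long_tails.
Context {R : realType}.
Implicit Types (g : R -> R) (P : probability R R).

(** A nonnegative threshold is convenient because a sum of thresholds then dominates each of
    them. *)
Lemma near_pinftyP (A : R -> Prop) :
  (\forall x \near +oo, A x) <-> exists2 x0 : R, 0 <= x0 & forall x, x0 <= x -> A x.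
Proof.
split => [[M [Mr hM]]|[M M0 hM]].
  exists (`|M| + 1); first by rewrite addr_ge0.
  by move=> x Mx; apply: hM; rewrite (lt_le_trans _ Mx)// (le_lt_trans (ler_norm _))// ltrDl.
by exists M; split; [exact: num_real|move=> x /ltW; exact: hM].
Qed.

Lemma near_pinftyB (A : R -> Prop) (K : R) : (\forall x \near +oo, A x) ->
  \forall x \near +oo, forall y, y <= K -> A (x - y).
Proof.
move=> /near_pinftyP[x0 x00 h]; apply/near_pinftyP; exists (x0 + `|K|).
  by rewrite addr_ge0.
move=> x xK y yK; apply: h; rewrite lerBrDr (le_trans _ xK)// lerD2l.
by rewrite (le_trans yK)// ler_norm.
Qed.

(** The forms without division make sense also where g vanishes. The lower half stands alone because
    for T = oo monotonicity provides it before G is known to be long-tailed. *)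
Definition long_lower g := forall K e : R, 0 < e ->
  \forall x \near +oo, forall y, 0 <= y <= K -> (1 - e) * g x <= g (x - y).

Definition long_upper g := forall K e : R, 0 < e ->
  \forall x \near +oo, forall y, 0 <= y <= K -> g (x - y) <= (1 + e) * g x.

Definition slowly g := forall K e : R, 0 < e ->
  \forall x \near +oo, forall t, 0 <= t <= K ->
    (1 - e) * g x <= g (x + t) <= (1 + e) * g x.

Lemma slowly_unit g : (forall x, 0 <= g x) ->
  (forall e : R, 0 < e -> \forall x \near +oo, forall t, 0 <= t <= 1 ->
    (1 - e) * g x <= g (x + t) <= (1 + e) * g x) -> slowly g.
Proof.
move=> g0 h.
suff hn n (e : R) : 0 < e -> \forall x \near +oo, forall t, 0 <= t <= n%:R ->
    (1 - e) * g x <= g (x + t) <= (1 + e) * g x.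
  move=> K e e0; have := hn (Num.truncn K).+1 e e0; apply: filterS => x hx t.
  move=> /andP[t0 tK]; apply: hx; rewrite t0/= (le_trans tK)// ltW//.
  exact: truncnS_gt.
elim: n e => [|n ih] e e0.
  apply: nearW => x t; rewrite -eq_le => /eqP <-; rewrite addr0.
  by rewrite !ler_peMl ?ler_piMl// ?g0 ?gerBl ?lerDl ltW.
(* For d <= 1, (1 + d)^2 <= 1 + 3 d <= 1 + e. *)
pose d := Num.min (e / 3) 1.
have d0 : 0 < d by rewrite lt_min divr_gt0/=.
have d1 : d <= 1 by rewrite ge_min lexx orbT.
have de : 3 * d <= e by rewrite mulrC -ler_pdivlMr// ge_min lexx.
have /near_pinftyP[x1 x10 h1] := h d d0.
have /near_pinftyP[x2 x20 h2] := ih d d0.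
apply/near_pinftyP; exists (Num.max x1 x2); first by rewrite le_max x10.
move=> x; rewrite ge_max => /andP[xx1 xx2] t /andP[t0 tn].
have [tn'|tn'] := leP t n%:R.
  have /andP[ha hb] : (1 - d) * g x <= g (x + t) <= (1 + d) * g x.
    by apply: h2 => //; rewrite t0.
  have de' : d <= e by apply: le_trans de; lra.
  by rewrite (le_trans _ ha) ?(le_trans hb)// ler_wpM2r ?g0 ?lerD2l ?lerN2.
have n0 : (0 : R) <= n%:R by [].
have /andP[ha hb] : (1 - d) * g x <= g (x + n%:R) <= (1 + d) * g x.
  by apply: h2 => //; rewrite n0 lexx.
have /andP[hc hd] : (1 - d) * g (x + n%:R) <= g (x + n%:R + (t - n%:R)) <= (1 + d) * g (x + n%:R).
  apply: h1; first by rewrite (le_trans xx1)// lerDl.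
  by rewrite subr_ge0 (ltW tn')/= lerBlDr addrC natr1.
have -> : x + t = x + n%:R + (t - n%:R) by ring.
have gx := g0 x.
have dd : d * d <= d by rewrite ler_piMl// ltW.
have dd0 : 0 <= d * d by rewrite mulr_ge0// ltW.
apply/andP; split.
  apply: le_trans hc; apply: (@le_trans _ _ ((1 - d) * ((1 - d) * g x))).
    rewrite mulrA ler_wpM2r//; lra.
  by rewrite ler_wpM2l// subr_ge0.
apply: (le_trans hd); apply: (@le_trans _ _ ((1 + d) * ((1 + d) * g x))).
  by rewrite ler_wpM2l// addr_ge0// ltW.
rewrite mulrA ler_wpM2r//; lra.
Qed.

Lemma slowly_long_lower g : (forall x, 0 <= g x) -> slowly g -> long_lower g.
Proof.
move=> g0 h K e e0.
have := near_pinftyB _ K (h K _ e0); apply: filterS => x hx y /andP[y0 yK].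
have := hx y yK y; rewrite y0 yK subrK => /(_ isT)/andP[_ hy].
have [e1|e1] := leP 1 e.
  by apply: le_trans (g0 _); rewrite mulr_le0_ge0// subr_le0.
apply: (@le_trans _ _ ((1 - e) * ((1 + e) * g (x - y)))).
  by rewrite ler_wpM2l// subr_ge0 ltW.
rewrite mulrA ler_piMl//.
have : 0 <= e * e by rewrite mulr_ge0// ltW.
lra.
Qed.

Lemma slowly_long_upper g : (forall x, 0 <= g x) -> slowly g -> long_upper g.
Proof.
move=> g0 h K e e0.
have e1 : 0 < 1 + e by rewrite addr_gt0.
have d0 : 0 < e / (1 + e) by rewrite divr_gt0.
have := near_pinftyB _ K (h K _ d0); apply: filterS => x hx y /andP[y0 yK].
have := hx y yK y; rewrite y0 yK subrK => /(_ isT)/andP[hy _].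
rewrite -ler_pdivrMl//; apply: le_trans hy.
rewrite le_eqVlt; apply/orP; left; apply/eqP; field.
by rewrite gt_eqF.
Qed.

(** A step of length at most 1 costs at most the factor 4/3 < 3/2 <= e^{1/2}; the + 1 in the
    exponent pays for the last partial step. The rate 1/2 is chosen below the rate 1 of the
    exponential moments, which leaves room in [light_perturbation]. *)
Lemma slowly_exp g : (forall x, 0 <= g x) -> slowly g ->
  exists2 x0 : R, 0 <= x0 & forall u y, x0 <= u -> 0 <= y ->
    g u <= expR ((y + 1) / 2) * g (u + y).
Proof.
move=> g0 h.
have q0 : (0 : R) < 1 / 4 by rewrite divr_gt0.
have /near_pinftyP[x0 x00 hx] := h 1 _ q0.
exists x0 => // u y ux0 y0.
have e12 : 3 / 2 <= expR (1 / 2 : R) by have := @expR_ge1Dx R (1 / 2); lra.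
have step v t : x0 <= v -> 0 <= t <= 1 -> g v <= expR (1 / 2) * g (v + t).
  move=> vx0 t01; have /andP[h1 _] := hx v vx0 t t01.
  apply: (@le_trans _ _ (expR (1 / 2) * ((1 - 1 / 4) * g v))).
    by rewrite mulrA ler_peMl//; lra.
  by rewrite ler_wpM2l// expR_ge0.
have main n : forall v t, x0 <= v -> 0 <= t <= 1 ->
    g v <= expR ((n%:R + 1) / 2) * g (v + (n%:R + t)).
  elim: n => [|n ih] v t vx0 t01; first by rewrite !add0r; exact: step.
  have i1 : 0 <= (1 : R) <= 1 by rewrite ler01 lexx.
  apply: (le_trans (step v 1 vx0 i1)).
  have -> : (n.+1%:R + 1) / 2 = 1 / 2 + (n%:R + 1) / 2 :> R by rewrite -natr1; field.
  rewrite expRD -mulrA ler_wpM2l ?expR_ge0//.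
  have -> : v + (n.+1%:R + t) = v + 1 + (n%:R + t) by rewrite -natr1; ring.
  by apply: ih => //; rewrite (le_trans vx0)// lerDl.
pose n := Num.truncn y; have /andP[n1 n2] := truncn_itv y0.
apply: (@le_trans _ _ (expR ((n%:R + 1) / 2) * g (u + (n%:R + (y - n%:R))))).
  apply: main => //; rewrite subr_ge0 n1/= lerBlDr addrC natr1.
  exact: ltW.
have -> : u + (n%:R + (y - n%:R)) = u + y by ring.
by rewrite ler_wpM2r// ler_expR ler_pM2r// lerD2r.
Qed.

End long_tails.

Section convolution_powers.
Context {R : realType} (T : \bar R) (G : probability R R).
Hypothesis G0 : G `]-oo, 0[%classic = 0%E.

Let g := locmass T G.
Let g_ge0 x : 0 <= g x. Proof. exact: locmass_ge0. Qed.
Let q n := locmass T (convpow G n).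
Let q_ge0 n x : 0 <= q n x. Proof. exact: locmass_ge0. Qed.

Lemma pr_near1 (P : probability R R) (e : R) : P `]-oo, 0[%classic = 0%E -> 0 < e ->
  \forall A \near +oo, 1 - e <= pr P `[0, A]%classic.
Proof.
move=> P0 e0.
pose B n : set R := `[0, n%:R]%classic.
have mB n : measurable (B n) by exact: measurable_itv.
have UB : \bigcup_n B n = `[0, +oo[%classic.
  apply/seteqP; split => y.
    by move=> [n _]; rewrite /B/= !in_itv/= andbT => /andP[].
  rewrite /= in_itv/= andbT => y0; exists (Num.truncn y).+1 => //.
  by rewrite /B/= in_itv/= y0 ltW// truncnS_gt.
have ndB : {homo B : n m / (n <= m)%N >-> (n <= m)%O}.
  move=> n m nm; apply/subsetPset => y; rewrite /B/= !in_itv/= => /andP[-> /=].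
  by move=> /le_trans; apply; rewrite ler_nat.
have P1 : pr P `[0, +oo[%classic = 1.
  have := prC P `]-oo, 0[%classic; rewrite /pr P0 subr0 setCitvl; apply.
  exact: measurable_itv.
have : P (B n) @[n --> \oo] --> (1%R : R)%:E.
  rewrite -P1 -(prE P _ (measurable_itv `[0, +oo[)) -UB.
  by apply: nondecreasing_cvg_mu => //; exact: bigcup_measurable.
move=> /fine_cvgP[_] /cvgrPdist_le /(_ e e0)[N _ /(_ N (leqnn N))] hN.
apply/near_pinftyP; exists N%:R => // A NA.
move: hN => /= /ler_normlW; rewrite lerBlDr -lerBlDl => /le_trans; apply.
apply: le_pr => // y; rewrite /B/= !in_itv/= => /andP[-> /=].
by move=> /le_trans; exact.
Qed.

(** The sum of n + 1 terms is large if the last is large while the others add up to at most A, or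
    the other way round. The shift y belongs to the induction: the step evaluates [q n] at x - y - z
    with z in [0, A], so the range grows from K to K + A. *)
Lemma convpow_lower n (K e : R) : long_lower g -> 0 < e ->
  \forall x \near +oo, forall y, 0 <= y <= K -> (n%:R - e) * g x <= q n (x - y).
Proof.
move=> gl; elim: n K e => [|n ih] K e e0.
  by apply: nearW => x y _; apply: le_trans (q_ge0 _ _); rewrite mulr_le0_ge0// sub0r oppr_le0 ltW.
pose d := Num.min (e / (4 * n.+1%:R)) (1 / 2).
have d0 : 0 < d by rewrite lt_min !divr_gt0//= mulr_gt0.
have d1 : d <= 1 / 2 by rewrite ge_min lexx orbT.
have de : 4 * n.+1%:R * d <= e by rewrite mulrC -ler_pdivlMr ?mulr_gt0// ge_min lexx.
have [A [A0 hA1 hA2]] : exists A : R, [/\ 0 <= A, 1 - d <= pr (convpow G n) `[0, A]%classic &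
    1 - d <= pr G `[0, A]%classic].
  have /near_pinftyP[A1 A10 h1] := pr_near1 (convpow G n) d (convpow_nneg _ _ G0) d0.
  have /near_pinftyP[A2 A20 h2] := pr_near1 G d G0 d0.
  exists (Num.max A1 A2); split; first by rewrite le_max A10.
    by apply: h1; rewrite le_max lexx.
  by apply: h2; rewrite le_max lexx orbT.
have /near_pinftyP[x1 x10 h1] := gl (K + A) d d0.
have /near_pinftyP[x2 x20 h2] := ih (K + A) d d0.
apply/near_pinftyP; exists (x1 + x2 + (A + A) + `|K|); first by rewrite !addr_ge0.
move=> x hx y /andP[y0 yK].
have K0 := le_trans y0 yK; rewrite (ger0_norm K0) in hx.
have xx1 : x1 <= x by lra.
have xx2 : x2 <= x by lra.
have xA : A + A <= x - y by lra.
have mI : measurable (`[0, A]%classic : set R) by exact: measurable_itv.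
have hz z : `[0, A]%classic z -> z <= A /\ (1 - d) * g x <= locmass T G (x - y - z).
  rewrite /= in_itv/= => /andP[z0 zA]; split => //.
  rewrite -addrA -opprD; apply: h1 => //; rewrite addr_ge0//=; exact: lerD.
have hz' z : `[0, A]%classic z -> z <= A /\ (n%:R - d) * g x <= locmass T (convpow G n) (x - y - z).
  rewrite /= in_itv/= => /andP[z0 zA]; split => //.
  rewrite -addrA -opprD; apply: h2 => //; rewrite addr_ge0//=; exact: lerD.
apply: le_trans (locmass_convp_ge T (convpow G n) G (x - y) A _ _ _ _ mI mI hz hz' xA).
have gx := g_ge0 x.
have pG1 := pr_le1 G _ mI.
have pP1 := pr_le1 (convpow G n) _ mI.
set pP := pr _ _ in hA1 pP1 *; set pG := pr _ _ in hA2 pG1 *.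
have -> : (1 - d) * g x * pP + (n%:R - d) * g x * pG =
  ((1 - d) * pP + (n%:R - d) * pG) * g x by ring.
rewrite ler_wpM2r//.
move: de; rewrite -natr1 => de.
have n0 : (0 : R) <= n%:R by [].
have t1 : (1 - d) * (1 - d) <= (1 - d) * pP by rewrite ler_wpM2l// subr_ge0; lra.
have t2 : n%:R * (1 - d) <= n%:R * pG by rewrite ler_wpM2l.
have t3 : d * pG <= d by rewrite ler_piMr// ltW.
have t4 : 0 <= d * d by rewrite mulr_ge0// ltW.
have t5 : 0 <= n%:R * d by rewrite mulr_ge0// ltW.
have -> : (n%:R - d) * pG = n%:R * pG - d * pG by ring.
lra.
Qed.

End convolution_powers.

(** * Kesten's bound and upper bounds for convolution powers *)

Section kesten.
Context {R : realType} (T : \bar R) (G : probability R R).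
Hypothesis G0 : G `]-oo, 0[%classic = 0%E.

Let g := locmass T G.
Let g_ge0 x : 0 <= g x. Proof. exact: locmass_ge0. Qed.
Let q n := locmass T (convpow G n).
Let q_ge0 n x : 0 <= q n x. Proof. exact: locmass_ge0. Qed.

Hypothesis gs : slowly g.
Hypothesis g_gt0 : \forall x \near +oo, 0 < g x.
Hypothesis g2_le : forall e : R, 0 < e ->
  \forall x \near +oo, locmass T (convp G G) x <= (2 + e) * g x.

Let q0E x : 0 <= x -> q 0 x = 0.
Proof.
move=> x0; have h : dirac_prob 0 (shiftD T x) = 0%E.
  rewrite /dirac_prob/= diracE memNset//.
  by rewrite /shiftD/= => -[]; rewrite ltNge x0.
exact: (congr1 fine h).
Qed.

(** Induction on n through [locmass_convp_le] with C = r^n. Its hypothesis needs the bound for n on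
    all of [A, oo), so the threshold must not move with n. Beyond x1 the step gives (2 + 2 C + 3 C)
    g x <= 7 C g x; on [A, x1) the trivial bound 1 <= B g x takes over, whence r = 7 + B. *)
Lemma kesten_bound : exists x0 r : R, [/\ 0 <= x0, 1 <= r &
  forall n x, x0 <= x -> q n x <= r ^+ n * g x].
Proof.
have [a0 a00 ha0] := slowly_exp g g_ge0 gs.
have /near_pinftyP[a1 a10 ha1] := g_gt0.
pose A := Num.max a0 a1.
have A0 : 0 <= A by rewrite le_max a00.
have Aa0 : a0 <= A by rewrite le_max lexx.
have gA : 0 < g A by apply: ha1; rewrite le_max lexx orbT.
have /near_pinftyP[b0 b00 hb0] := slowly_long_upper g g_ge0 gs A 1 ltr01.
have /near_pinftyP[b1 b10 hb1] := g2_le 1 ltr01.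
pose x1 := b0 + b1 + (A + A).
have x10 : A + A <= x1 by rewrite lerDr addr_ge0.
have xb0 : b0 <= x1 by rewrite /x1 -addrA lerDl !addr_ge0.
have xb1 : b1 <= x1 by rewrite /x1 addrAC lerDr !addr_ge0.
(* By [slowly_exp], g A <= e^{(x1 + 1) / 2} g x on [A, x1), that is, 1 <= B g x. *)
pose B := expR ((x1 + 1) / 2) / g A.
have B0 : 0 <= B by rewrite divr_ge0 ?expR_ge0// ltW.
exists A, (7 + B); split => //; first by rewrite ler_wpDr// ler1n.
have r1 : 1 <= 7 + B by rewrite ler_wpDr// ler1n.
elim=> [|n ih] x Ax.
  by rewrite q0E ?mulr_ge0 ?exprn_ge0 ?(le_trans A0 Ax)// (le_trans _ r1).
set C := (7 + B) ^+ n in ih *.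
have C1 : 1 <= C by rewrite exprn_ege1.
have C0 : 0 <= C by rewrite (le_trans _ C1).
have [xx1|xx1] := leP x1 x; last first.
  apply: (@le_trans _ _ 1); first exact: locmass_le1.
  have Bg : 1 <= B * g x.
    rewrite /B mulrAC ler_pdivlMr// mul1r.
    apply: le_trans (ha0 A (x - A) Aa0 _) _; first by rewrite subr_ge0.
    rewrite subrKC ler_wpM2r// ler_expR ler_pM2r// lerD2r.
    by rewrite (le_trans _ (ltW xx1))// gerBl.
  apply: (le_trans Bg); rewrite ler_wpM2r// exprS -[leLHS]mulr1.
  apply: ler_pM => //; first by rewrite lerDr.
have gx := g_ge0 x.
have hG y : 0 <= y <= A -> 0 <= locmass T G (x - y) <= 2 * g x.
  move=> yA; rewrite locmass_ge0/=; apply: hb0 => //; exact: le_trans xx1.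
have hP y : 0 <= y <= A -> locmass T (convpow G n) (x - y) <= C * (2 * g x).
  move=> yA; apply: (@le_trans _ _ (C * g (x - y))).
    by apply: ih; move: yA => /andP[_ yA]; lra.
  by rewrite ler_wpM2l//; have /andP[] := hG y yA.
have := @locmass_convp_le _ T (convpow G n) G x A (2 * g x) 0 (C * (2 * g x)) C
  (convpow_nneg _ _ G0) G0 _ _ C0 A0 (le_trans x10 xx1) hG hP ih.
rewrite !mulr_ge0// => /(_ isT isT); rewrite mul0r mulr0 subr0.
move=> /le_trans; apply; rewrite exprS -/C.
have := hb1 _ (le_trans xb1 xx1).
move=> /(ler_wpM2l C0) h2.
apply: (@le_trans _ _ ((2 + 5 * C) * g x)); first by lra.
rewrite ler_wpM2r//; apply: (@le_trans _ _ (7 * C)); first by lra.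
by rewrite ler_wpM2r// lerDl.
Qed.

(** In [locmass_convp_le] the part where both summands exceed A is at most C = r^n times what
    remains of G * G after its two main contributions, and (2 + d) - 2 (1 - d)^2 <= 5 d. As C comes
    from Kesten's bound, it is fixed before d and A. *)
Lemma convpow_upper n (e : R) : 0 < e ->
  \forall x \near +oo, q n x <= (n%:R + e) * g x.
Proof.
elim: n e => [|n ih] e e0.
  apply/near_pinftyP; exists 0 => // x x0.
  by rewrite q0E// mulr_ge0// add0r ltW.
have [x0 [r [x00 r1 hr]]] := kesten_bound.
pose C := r ^+ n.
have C0 : 0 <= C by rewrite exprn_ge0// (le_trans _ r1).
have n0 : (0 : R) <= n%:R by [].
have k0 : 0 < n%:R + 3 + 5 * C by rewrite ltr_wpDr ?mulr_ge0// ltr_wpDl.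
(* The total is (1 + d) + (n + d) (1 + d) + 5 C d, which is at most n + 1 + (n + 3 + 5 C) d as d * d
   <= d. *)
pose d := Num.min (e / (n%:R + 3 + 5 * C)) 1.
have d0 : 0 < d by rewrite lt_min divr_gt0/=.
have d1 : d <= 1 by rewrite ge_min lexx orbT.
have de : (n%:R + 3 + 5 * C) * d <= e by rewrite mulrC -ler_pdivlMr// ge_min lexx.
have /near_pinftyP[A1 A10 hA1] := pr_near1 G d G0 d0.
pose A := Num.max A1 x0.
have A0 : 0 <= A by rewrite le_max A10.
have hA : 1 - d <= pr G `[0, A]%classic by apply: hA1; rewrite le_max lexx.
have Ax0 : x0 <= A by rewrite le_max lexx orbT.
have /near_pinftyP[b1 b10 hb1] := slowly_long_upper g g_ge0 gs A d d0.
have /near_pinftyP[b2 b20 hb2] := slowly_long_lower g g_ge0 gs A d d0.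
have /near_pinftyP[b3 b30 hb3] := g2_le d d0.
have /near_pinftyP[b4 b40 hb4] := ih d d0.
apply/near_pinftyP; exists (b1 + b2 + b3 + b4 + (A + A)); first by rewrite !addr_ge0.
move=> x hx.
have xb1 : b1 <= x by lra.
have xb2 : b2 <= x by lra.
have xb3 : b3 <= x by lra.
have xb4 : b4 + A <= x by lra.
have xA : A + A <= x by lra.
have gx := g_ge0 x.
have hG y : 0 <= y <= A -> (1 - d) * g x <= locmass T G (x - y) <= (1 + d) * g x.
  by move=> yA; rewrite hb2//= hb1.
have nd0 : 0 <= n%:R + d by rewrite addr_ge0// ltW.
have hP y : 0 <= y <= A -> locmass T (convpow G n) (x - y) <= (n%:R + d) * ((1 + d) * g x).
  move=> yA; apply: (@le_trans _ _ ((n%:R + d) * g (x - y))).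
    by apply: hb4; move: yA => /andP[_ yA]; lra.
  by rewrite ler_wpM2l//; have /andP[] := hG y yA.
have hC u : A <= u -> locmass T (convpow G n) u <= C * locmass T G u.
  by move=> Au; apply: hr; exact: le_trans Au.
have := @locmass_convp_le _ T (convpow G n) G x A ((1 + d) * g x) ((1 - d) * g x)
  ((n%:R + d) * ((1 + d) * g x)) C
  (convpow_nneg _ _ G0) G0 _ _ C0 A0 xA hG hP hC.
have d10 : 0 <= 1 + d by rewrite addr_ge0// ltW.
rewrite !mulr_ge0// => /(_ isT isT) /le_trans; apply.
have h2 : locmass T (convp G G) x <= (2 + d) * g x by exact: hb3.
have h3 : (1 - d) * g x * (1 - d) <= (1 - d) * g x * pr G `[0, A]%classic.
  by rewrite ler_wpM2l// mulr_ge0// subr_ge0.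
have h4 : C * (locmass T (convp G G) x - 2 * ((1 - d) * g x * pr G `[0, A]%classic)) <=
    C * (5 * d * g x).
  rewrite ler_wpM2l//.
  have : 0 <= d * d * g x by rewrite !mulr_ge0// ltW.
  lra.
apply: (le_trans (lerD (lexx _) h4)).
have -> : (1 + d) * g x + (n%:R + d) * ((1 + d) * g x) + C * (5 * d * g x) =
  ((n%:R + 1) + ((n%:R + 2) * d + d * d + 5 * C * d)) * g x by ring.
apply: ler_wpM2r => //; rewrite -(natr1 n) lerD2l; apply: le_trans de.
have : d * d <= d by rewrite ler_piMl// ltW.
lra.
Qed.

End kesten.

(** * Compound Poisson tails and light-tailed perturbations *)

Section poisson_weights.
Context {R : realType} (w : R).
Hypothesis w0 : 0 <= w.
Let pw := @poisson_weight R w.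
Let pw0 n : 0 <= pw n. Proof. exact: poisson_weight_ge0. Qed.

Lemma sum_poisson_weight_le (a : R) N : 0 <= a ->
  \sum_(0 <= n < N) pw n * a ^+ n <= expR (w * (a - 1)).
Proof.
move=> a0; rewrite -lee_fin -(nneseries_poisson_weight w a w0 a0) -sumEFin.
by apply: nneseries_lim_ge => n _ _; rewrite lee_fin mulr_ge0 ?pw0 ?exprn_ge0.
Qed.

Lemma sum_poisson_weight_ge (a e : R) : 0 <= a -> 0 < e ->
  exists N0, forall N, (N0 <= N)%N ->
    expR (w * (a - 1)) - e <= \sum_(0 <= n < N) pw n * a ^+ n.
Proof.
move=> a0 e0.
have c : (fun N => \sum_(0 <= n < N) (pw n * a ^+ n)%:E)%E @ \oo --> (expR (w * (a - 1)))%:E.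
  rewrite -nneseries_poisson_weight//; apply: is_cvg_nneseries => n _ _.
  by rewrite lee_fin mulr_ge0 ?pw0 ?exprn_ge0.
have {c} : (fun N => \sum_(0 <= n < N) pw n * a ^+ n) @ \oo --> expR (w * (a - 1)).
  have -> : (fun N => \sum_(0 <= n < N) pw n * a ^+ n) =
    (fun N => fine (\sum_(0 <= n < N) (pw n * a ^+ n)%:E)%E).
    by apply/funext => N; rewrite sumEFin.
  exact: fine_cvg c.
move=> /cvgrPdist_le /(_ e e0)[N0 _ hN]; exists N0 => N NN.
by have := hN N NN => /= /ler_normlW; rewrite lerBlDr -lerBlDl.
Qed.

Lemma sum_poisson_weight_le1 N : \sum_(0 <= n < N) pw n <= 1.
Proof.
have := sum_poisson_weight_le 1 N ler01; rewrite subrr mulr0 expR0.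
by under eq_bigr do rewrite expr1n mulr1.
Qed.

Lemma sum_poisson_mean N :
  \sum_(0 <= n < N.+1) n%:R * pw n = w * \sum_(0 <= n < N) pw n.
Proof.
rewrite big_nat_recl// mul0r add0r mulr_sumr; apply: eq_bigr => n _.
rewrite /pw /poisson_weight /exp_coeff/= exprS factS natrM.
by field; rewrite nat1r !pnatr_eq0 /= gtn_eqF// fact_gt0.
Qed.

Lemma sum_poisson_mean_le N : \sum_(0 <= n < N) n%:R * pw n <= w.
Proof.
case: N => [|N]; first by rewrite big_nil.
by rewrite sum_poisson_mean ler_piMr// sum_poisson_weight_le1.
Qed.

Lemma sum_poisson_mean_ge (e : R) : 0 < e -> exists N0, forall N, (N0 <= N)%N ->
  w - e <= \sum_(0 <= n < N) n%:R * pw n.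
Proof.
move=> e0; have d0 : 0 < e / (w + 1) by rewrite divr_gt0// ltr_wpDl.
have [N0 hN] := sum_poisson_weight_ge 1 _ ler01 d0.
exists N0.+1 => -[//|N NN]; rewrite sum_poisson_mean.
have := hN N NN; rewrite subrr mulr0 expR0.
under eq_bigr do rewrite expr1n mulr1.
move=> /(ler_wpM2l w0); apply: le_trans.
rewrite mulrBr mulr1 lerD2l lerN2 mulrCA ler_piMr ?ltW//.
by rewrite ltr_pdivrMr ?mul1r ?ltrDl// ltr_wpDl.
Qed.

End poisson_weights.

Section compound_poisson_tail.
Context {R : realType}.

Lemma near_ord (A : nat -> R -> Prop) N :
  (forall n, (n < N)%N -> \forall x \near +oo, A n x) ->
  \forall x \near +oo, forall n, (n < N)%N -> A n x.
Proof.
elim: N => [|N ih] h; first by apply: nearW.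
have h1 := ih (fun n nN => h n (ltnW nN)); have h2 := h N (ltnSn N).
apply: filterS2 h1 h2 => x h1 h2 n; rewrite ltnS leq_eqVlt => /predU1P[->//|].
exact: h1.
Qed.

Variables (T : \bar R) (G : probability R R) (w : {nonneg R}).
Hypothesis G0 : G `]-oo, 0[%classic = 0%E.
Let g := locmass T G.
Let g_ge0 x : 0 <= g x. Proof. exact: locmass_ge0. Qed.
Let q n := locmass T (convpow G n).
Let q_ge0 n x : 0 <= q n x. Proof. exact: locmass_ge0. Qed.
Let W := w%:num.
Let W0 : 0 <= W. Proof. by rewrite /W. Qed.
Let pw := @poisson_weight R W.
Let pw0 n : 0 <= pw n. Proof. exact: poisson_weight_ge0. Qed.

Lemma locmass_cpoisson_ge N x : \sum_(0 <= n < N) pw n * q n x <= locmass T (cpoisson w G) x.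
Proof. by rewrite big_mkord; apply: pr_cpoisson_ge; exact: measurable_shiftD. Qed.

Lemma cpoisson_lower (e : R) : long_lower g -> 0 < e ->
  \forall x \near +oo, (W - e) * g x <= locmass T (cpoisson w G) x.
Proof.
move=> gl e0; have e2 : 0 < e / 2 by rewrite divr_gt0.
have [N hN] := sum_poisson_mean_ge W W0 (e / 2) e2.
have : \forall x \near +oo, forall n, (n < N)%N -> (n%:R - e / 2) * g x <= q n x.
  apply: near_ord => n _; have := convpow_lower T G G0 n 0 _ gl e2.
  by apply: filterS => x /(_ 0); rewrite subr0 lexx; exact.
apply: filterS => x hx; apply: le_trans (locmass_cpoisson_ge N x).
apply: (@le_trans _ _ (\sum_(0 <= n < N) pw n * ((n%:R - e / 2) * g x))); last first.
  by rewrite !big_mkord; apply: ler_sum => n _; rewrite ler_wpM2l// hx.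
have -> : \sum_(0 <= n < N) pw n * ((n%:R - e / 2) * g x) =
    (\sum_(0 <= n < N) n%:R * pw n - e / 2 * \sum_(0 <= n < N) pw n) * g x.
  by rewrite mulr_sumr -sumrB mulr_suml; apply: eq_bigr => n _; ring.
rewrite ler_wpM2r//.
have := hN N (leqnn N); have := sum_poisson_weight_le1 W W0 N.
move=> /(ler_wpM2l (ltW e2)); rewrite -/pw; lra.
Qed.

(** Dominated convergence by hand: [convpow_upper] for the finitely many terms below N0, and beyond
    N0 Kesten's bound against the convergent series of pw n r^n. *)
Lemma cpoisson_upper (e : R) : slowly g -> (\forall x \near +oo, 0 < g x) ->
  (forall e : R, 0 < e -> \forall x \near +oo, locmass T (convp G G) x <= (2 + e) * g x) ->
  0 < e -> \forall x \near +oo, locmass T (cpoisson w G) x <= (W + e) * g x.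
Proof.
move=> gs gp g2 e0; have e2 : 0 < e / 2 by rewrite divr_gt0.
have [x0 [r [x00 r1 hr]]] := kesten_bound T G G0 gs gp g2.
have r0 : 0 <= r by rewrite (le_trans _ r1).
have [N0 hN0] := sum_poisson_weight_ge W W0 r (e / 2) r0 e2.
have : \forall x \near +oo, forall n, (n < N0)%N -> q n x <= (n%:R + e / 2) * g x.
  by apply: near_ord => n _; exact: (convpow_upper T G G0 gs gp g2).
move=> /near_pinftyP[x1 x10 h1]; apply/near_pinftyP; exists (x0 + x1).
  by rewrite addr_ge0.
move=> x hx.
have xx0 : x0 <= x by rewrite (le_trans _ hx)// lerDl.
have xx1 : x1 <= x by rewrite (le_trans _ hx)// lerDr.
apply: pr_cpoisson_le; first exact: measurable_shiftD.
move=> N; rewrite -(big_mkord xpredT (fun n => pw n * q n x)).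
apply: (@le_trans _ _ (\sum_(0 <= n < N0 + N) pw n * q n x)).
  rewrite (@big_cat_nat _ _ _ N 0 (N0 + N))//= ?leq_addl// lerDl.
  by apply: sumr_ge0 => n _; rewrite mulr_ge0.
rewrite (@big_cat_nat _ _ _ N0 0 (N0 + N))//= ?leq_addr//.
have t1 : \sum_(0 <= n < N0) pw n * q n x <= (W + e / 2) * g x.
  apply: (@le_trans _ _ (\sum_(0 <= n < N0) pw n * ((n%:R + e / 2) * g x))).
    by rewrite !big_mkord; apply: ler_sum => n _; rewrite ler_wpM2l// h1.
  have -> : \sum_(0 <= n < N0) pw n * ((n%:R + e / 2) * g x) =
      (\sum_(0 <= n < N0) n%:R * pw n + e / 2 * \sum_(0 <= n < N0) pw n) * g x.
    by rewrite mulr_sumr -big_split/= mulr_suml; apply: eq_bigr => n _; ring.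
  rewrite ler_wpM2r// lerD// ?sum_poisson_mean_le//.
  by rewrite ler_piMr ?(ltW e2)// sum_poisson_weight_le1.
have t2 : \sum_(N0 <= n < N0 + N) pw n * q n x <= e / 2 * g x.
  apply: (@le_trans _ _ (\sum_(N0 <= n < N0 + N) pw n * (r ^+ n * g x))).
    by apply: ler_sum => n _; rewrite ler_wpM2l// hr.
  under eq_bigr do rewrite mulrA.
  rewrite -mulr_suml ler_wpM2r//.
  have := sum_poisson_weight_le W W0 r (N0 + N) r0.
  rewrite (@big_cat_nat _ _ _ N0 0 (N0 + N))//= ?leq_addr//.
  have := hN0 N0 (leqnn _); rewrite -/pw; lra.
apply: (le_trans (lerD t1 t2)).
by rewrite -mulrDl -addrA -splitr.
Qed.

End compound_poisson_tail.

Section light_perturbation.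
Context {R : realType}.

Lemma near_expR_small (K eta : R) : 0 < eta ->
  \forall x \near +oo, K * expR (- (x / 2)) <= eta.
Proof.
move=> eta0; apply/near_pinftyP; exists (`|K| / eta * 2).
  by rewrite mulr_ge0// divr_ge0// ltW.
move=> x hx; apply: (@le_trans _ _ (`|K| * expR (- (x / 2)))).
  by rewrite ler_wpM2r ?expR_ge0// ler_norm.
rewrite expRN ler_pdivrMr ?expR_gt0// mulrC -ler_pdivrMr//.
have := @expR_ge1Dx R (x / 2).
have : `|K| / eta <= x / 2 by rewrite ler_pdivlMr.
lra.
Qed.

Variables (T : \bar R) (C : probability R R) (M : R).
Hypothesis M0 : 0 <= M.
Let c := locmass T C.
Let c_ge0 x : 0 <= c x. Proof. exact: locmass_ge0. Qed.
Hypothesis cs : slowly c.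
Hypothesis c_gt0 : \forall x \near +oo, 0 < c x.

(** The threshold for x comes before the quantifier on H, so the bound survives the limit along
    [H k] at fixed x. The reason is that c (x - y) / c x grows in y at most like e^{y/2}, while H
    has a bounded moment of e^y. *)
Lemma light_perturbation (e : R) : 0 < e -> \forall x \near +oo,
  forall H : probability R R, H `]-oo, 0[%classic = 0%E -> (mgf 1 H <= M%:E)%E ->
  (1 - e) * c x <= locmass T (convp H C) x <= (1 + e) * c x.
Proof.
move=> e0; pose d := Num.min (e / 3) 1.
have d0 : 0 < d by rewrite lt_min divr_gt0/=.
have d1 : d <= 1 by rewrite ge_min lexx orbT.
have de : 3 * d <= e by rewrite mulrC -ler_pdivlMr// ge_min lexx.
have [x0 x00 hx0] := slowly_exp c c_ge0 cs.
have /near_pinftyP[a1 a10 ha1] := c_gt0.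
have /near_pinftyP[A A0 hA] := near_expR_small (expR (1 / 2) * M) d d0.
have hAA := hA A (lexx _).
have hA' : M * expR (- A) <= d.
  apply: le_trans hAA; rewrite (mulrC (expR _)) -mulrA.
  apply: ler_wpM2l => //; rewrite -expRD ler_expR; lra.
pose u0 := Num.max x0 a1.
have u0x0 : x0 <= u0 by rewrite le_max lexx.
have cu0 : 0 < c u0 by apply: ha1; rewrite le_max lexx orbT.
have /near_pinftyP[b1 b10 hb1] := slowly_long_upper c c_ge0 cs A d d0.
have /near_pinftyP[b2 b20 hb2] := slowly_long_lower c c_ge0 cs A d d0.
have eta0 : 0 < d * c u0 by rewrite mulr_gt0.
have /near_pinftyP[b3 b30 hb3] := near_expR_small (M * expR (x0 + 1 / 2)) _ eta0.
apply/near_pinftyP; exists (b1 + b2 + b3 + u0 + (A + A)).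
  by rewrite !addr_ge0// (le_trans x00).
have u00 : 0 <= u0 by rewrite (le_trans x00).
move=> x hx H H0 HM.
have xb1 : b1 <= x by lra.
have xb2 : b2 <= x by lra.
have xb3 : b3 <= x by lra.
have xu0 : u0 <= x by lra.
have xA : A + A <= x by lra.
have cx := c_ge0 x.
have mI : measurable (`[0, A]%classic : set R) by exact: measurable_itv.
apply/andP; split.
  have h1 y : `[0, A]%classic y -> y <= A /\ (1 - d) * c x <= locmass T C (x - y).
    by rewrite /= in_itv/= => yA; split; [have /andP[] := yA|exact: hb2].
  have h2 z : (set0 : set R) z -> z <= A /\ 0 <= locmass T H (x - z) by [].
  have := locmass_convp_ge T H C x A ((1 - d) * c x) 0 _ set0 mI measurable0 h1 h2 xA.
  rewrite mul0r addr0; apply: le_trans.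
  have pH : 1 - d <= pr H `[0, A]%classic.
    by apply: le_trans (pr_ge_mgf H A M H0 HM A0); rewrite lerD2l lerN2.
  have d1' : 0 <= (1 - d) * c x by rewrite mulr_ge0// subr_ge0.
  apply: le_trans (ler_wpM2l d1' pH).
  rewrite mulrAC; apply: ler_wpM2r => //.
  have : 0 <= d * d by rewrite mulr_ge0// ltW.
  lra.
(* Two ranges beyond A. For A < y <= x - x0, [slowly_exp] gives c (x - y) <= e^{(y + 1) / 2} c x <=
   e^{1/2} e^{-A/2} e^y c x; for y > x - x0 the bound is 1 <= e^{x0 - x} e^y. *)
pose be := expR (1 / 2) * expR (- (A / 2)) * c x + expR (x0 - x).
have be0 : 0 <= be by rewrite addr_ge0 ?mulr_ge0 ?expR_ge0.
have al0 : 0 <= (1 + d) * c x by rewrite mulr_ge0// addr_ge0// ltW.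
apply: (@le_trans _ _ ((1 + d) * c x + be * M)).
  apply: locmass_convp_le_mgf => // y y0.
  have [yA|yA] := leP y A.
    apply: (@le_trans _ _ ((1 + d) * c x)); first by apply: hb1; rewrite ?y0.
    by rewrite lerDl mulr_ge0 ?expR_ge0.
  apply: (@le_trans _ _ (be * expR y)); last by rewrite lerDr.
  rewrite /be mulrDl; have [yx|yx] := leP y (x - x0).
    apply: (@le_trans _ _ (expR (1 / 2) * expR (- (A / 2)) * c x * expR y)); last first.
      by rewrite lerDl mulr_ge0 ?expR_ge0.
    have x0y : x0 <= x - y by lra.
    apply: (le_trans (hx0 (x - y) y x0y y0)); rewrite subrK mulrAC.
    apply: ler_wpM2r => //; rewrite -!expRD ler_expR; lra.
  apply: (@le_trans _ _ 1); first exact: locmass_le1.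
  apply: (@le_trans _ _ (expR (x0 - x) * expR y)); last first.
    by rewrite lerDr !mulr_ge0 ?expR_ge0.
  by rewrite -expRD -expR0 ler_expR; lra.
have t1 : expR (1 / 2) * expR (- (A / 2)) * c x * M <= d * c x.
  rewrite mulrAC; apply: ler_wpM2r => //; apply: le_trans hAA.
  by rewrite mulrAC.
(* The term e^{-x} is negligible, as c decays no faster than e^{-x/2} by [slowly_exp] started at u0;
   the constant in [hb3] is fitted to this. *)
have t2 : expR (x0 - x) * M <= d * c x.
  have xu00 : 0 <= x - u0 by rewrite subr_ge0.
  have k1 := hx0 u0 (x - u0) u0x0 xu00; rewrite subrKC in k1.
  have k2 := le_trans (hb3 x xb3) (ler_wpM2l (ltW d0) k1).
  have k3 : expR ((x - u0 + 1) / 2) = expR (x / 2 + 1 / 2) * expR (- (u0 / 2)).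
    by rewrite -expRD; congr expR; field.
  have k4 : expR (- (u0 / 2)) <= 1 by rewrite -expR0 ler_expR oppr_le0 divr_ge0.
  have k5 : M * expR (x0 + 1 / 2) * expR (- (x / 2)) <= d * c x * expR (x / 2 + 1 / 2).
    apply: (le_trans k2); rewrite k3.
    have -> : d * (expR (x / 2 + 1 / 2) * expR (- (u0 / 2)) * c x) =
      d * c x * expR (x / 2 + 1 / 2) * expR (- (u0 / 2)) by ring.
    by rewrite ler_piMr// !mulr_ge0 ?expR_ge0// ltW.
  rewrite -(ler_pM2r (expR_gt0 (x / 2 + 1 / 2))); apply: le_trans k5.
  rewrite (mulrC _ M) -!mulrA; apply: ler_wpM2l => //.
  by rewrite -!expRD ler_expR; lra.
rewrite /be mulrDl.
have := ler_wpM2r cx de; lra.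
Qed.

End light_perturbation.

Section identities.
Context {R : realType}.
Implicit Types P Q : probability R R.

Let mpre (B : set R) : measurable B -> measurable (@addp R @^-1` B).
Proof.
by move=> mB; rewrite -[X in measurable X]setTI; exact: measurable_addp.
Qed.

Lemma pr_convp_dirac0 P (B : set R) : measurable B ->
  pr (convp (dirac_prob 0) P) B = pr P B.
Proof.
move=> mB; rewrite /pr; congr fine.
have -> : convp (dirac_prob 0) P B =
    (\int[\d_(0%R : R)]_y P (xsection (@addp R @^-1` B) y))%E by [].
rewrite integral_dirac//; last first.
  by apply: measurable_fun_xsection; exact: mpre.
rewrite diracT mul1e; congr (P _).
by apply/seteqP; split => z; rewrite /xsection/= inE/= /addp/= add0r.
Qed.

Lemma eq_convp P P' Q (B : set R) :
  (forall A, measurable A -> pr P A = pr P' A) -> measurable B ->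
  pr (convp P Q) B = pr (convp P' Q) B.
Proof.
move=> PP' mB; rewrite !(pr_convpC _ Q)//.
have h (P1 P2 : probability R R) : (forall A, measurable A -> pr P1 A = pr P2 A) ->
    pr (convp Q P1) B <= pr (convp Q P2) B.
  move=> P12; rewrite -[leRHS]mul1r.
  apply: (@pr_prod_le _ Q P1 P2 (@addp R @^-1` B) (@addp R @^-1` B) setT) => //.
  - exact: mpre.
  - exact: mpre.
  - by rewrite setCT measure0.
  - move=> y _; rewrite mul1r P12//.
    by apply: measurable_xsection; exact: mpre.
by apply/eqP; rewrite eq_le !h// => A mA; rewrite PP'.
Qed.

(** The powers start from the unit mass at 0, so the second power agrees with [convp P P] on
    measurable sets but is not the same term. *)
Lemma locmass_convpow2 (T : \bar R) P x : locmass T (convpow P 2) x = locmass T (convp P P) x.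
Proof.
apply: (@eq_convp (convpow P 1) P P); last exact: measurable_shiftD.
by move=> A mA; exact: pr_convp_dirac0.
Qed.

End identities.

(** * From an upper bound for F to an upper bound for G * G *)

Section converse.
Context {R : realType} (T : \bar R) (G F : probability R R) (w : {nonneg R}).
Hypothesis G0 : G `]-oo, 0[%classic = 0%E.
Let g := locmass T G.
Let g_ge0 x : 0 <= g x. Proof. exact: locmass_ge0. Qed.
Let g2 := locmass T (convp G G).
Let W := w%:num.
Hypothesis W0 : 0 < W.
Let pw := @poisson_weight R W.
Let pw0 n : 0 <= pw n. Proof. exact: poisson_weight_ge0 (ltW W0). Qed.
Variables (H : nat -> probability R R) (M : R).
Hypothesis H0 : forall k, H k `]-oo, 0[%classic = 0%E.
Hypothesis HM : forall k, (mgf 1 (H k) <= M%:E)%E.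
Hypothesis HF : forall x, 0 <= x ->
  locmass T (convp (H k) (cpoisson w G)) x @[k --> \oo] --> locmass T F x.
Hypothesis gl : long_lower g.
Hypothesis Fg : forall e : R, 0 < e -> \forall x \near +oo, locmass T F x <= (W + e) * g x.

(* Every term of the compound Poisson series except the one with n = 2 is bounded
   below by its limit; since the sum is at most (W + e) g, the term n = 2 cannot
   exceed its own limit. *)
Lemma converse_g2 (e : R) : 0 < e -> exists2 K : R, 0 <= K & forall s : R,
  (forall d : R, 0 < d -> \forall x \near +oo, forall y, 0 <= y <= K ->
     (1 - d) * g2 (x - s) - d * g x <= g2 (x - y)) ->
  \forall x \near +oo, g2 (x - s) <= (2 + e) * g x.
Proof.
move=> e0.
have p2 : 0 < pw 2.
  by rewrite /pw /poisson_weight mulr_gt0 ?expR_gt0// /exp_coeff/= divr_gt0// exprn_gt0.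
set p := pw 2 in p2.
have e2 : 0 < 2 + e by rewrite addr_gt0.
have pe : 0 < 2 * p * (2 + e) by rewrite mulr_gt0// mulr_gt0.
have D0 : 0 < 3 + W + 2 * p * (2 + e) by rewrite addr_gt0// addr_gt0.
(* At the end p (1 - d)^2 z <= (2 p + d (3 + W)) g x. The term 3 + W absorbs this excess, and 2 p (2
   + e) absorbs the loss in (1 - d)^2 >= 1 - 2 d. *)
pose d := Num.min (p * e / (3 + W + 2 * p * (2 + e))) (1 / 2).
have d0 : 0 < d by rewrite lt_min !divr_gt0//= mulr_gt0.
have d1 : d <= 1 / 2 by rewrite ge_min lexx orbT.
have de : (3 + W + 2 * p * (2 + e)) * d <= p * e.
  by rewrite mulrC -ler_pdivlMr// ge_min lexx.
have /near_pinftyP[K K0 hK] := near_expR_small M d d0.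
have HK k : 1 - d <= pr (H k) `[0, K + K]%classic.
  apply: le_trans (pr_ge_mgf (H k) (K + K) M (H0 k) (HM k) _); last by rewrite addr_ge0.
  rewrite lerD2l lerN2; apply: le_trans (hK (K + K + (K + K)) _); last first.
    by rewrite -addrA lerDl !addr_ge0.
  by have -> : (K + K + (K + K)) / 2 = K + K by field.
exists (K + K); first by rewrite addr_ge0.
move=> s hs.
have [N0 hN0] := sum_poisson_mean_ge W (ltW W0) d d0.
(* At least 3, so that n = 2 is among the terms. *)
pose N := (N0 + 3)%N.
have hN : W - d <= \sum_(0 <= n < N) n%:R * pw n by apply: hN0; rewrite leq_addr.
have : \forall x \near +oo, forall n, (n < N)%N -> forall y, 0 <= y <= K + K ->
    (n%:R - d) * g x <= locmass T (convpow G n) (x - y).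
  by apply: near_ord => n _; exact: convpow_lower.
move=> /near_pinftyP[x1 x10 h1].
have /near_pinftyP[x2 x20 h2] := hs d d0.
have /near_pinftyP[x3 x30 h3] := Fg d d0.
have KK : 0 <= K + K by rewrite addr_ge0.
apply/near_pinftyP; exists (x1 + x2 + x3 + (K + K + (K + K))).
  by rewrite !addr_ge0.
move=> x hx.
have xx1 : x1 <= x by lra.
have xx2 : x2 <= x by lra.
have xx3 : x3 <= x by lra.
have xK : (K + K) + (K + K) <= x by lra.
have x0 : 0 <= x by lra.
have gx := g_ge0 x.
set z := g2 (x - s).
(* Each n contributes pw n (n - d) g x; at n = 2 the correction turns (2 - d) g x into (1 - d) z - d
   g x, the lower bound supplied by [hs]. *)
pose L := (\sum_(0 <= n < N) pw n * (n%:R - d)) * g x + p * ((1 - d) * z - 2 * g x).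
have hL y : `[0, K + K]%classic y -> y <= K + K /\ L <= locmass T (cpoisson w G) (x - y).
  rewrite /= in_itv/= => yK; split; first by have /andP[] := yK.
  apply: le_trans (locmass_cpoisson_ge T G w N (x - y)).
  have -> : L = \sum_(0 <= n < N) pw n * ((n%:R - d) * g x +
      (n == 2)%:R * ((1 - d) * z - 2 * g x)).
    rewrite /L mulr_suml; under [RHS]eq_bigr do rewrite mulrDr mulrA.
    rewrite big_split/=; congr (_ + _).
    rewrite (bigD1_seq 2%N)//= ?mem_index_iota ?iota_uniq ?leq_addl//=.
    rewrite mul1r big1 ?addr0// => n /negbTE ->.
    by rewrite mul0r mulr0.
  rewrite !big_mkord; apply: ler_sum => n _; apply: ler_wpM2l => //.
  have hn := h1 x xx1 n (ltn_ord n) y yK.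
  have [n2|n2] := eqVneq (nat_of_ord n) 2%N; last by rewrite mul0r addr0.
  have := h2 x xx2 y yK; rewrite mul1r n2 locmass_convpow2 -/g2 -/z; lra.
have LF : (1 - d) * L <= locmass T F x.
  have [L0|L0] := leP L 0.
    by apply: le_trans (locmass_ge0 _ _ _); rewrite mulr_ge0_le0// subr_ge0; lra.
  apply: (cvgr_to_ge (HF x x0)); apply: nearW => k.
  have mI : measurable (`[0, K + K]%classic : set R) by exact: measurable_itv.
  have h0 z' : (set0 : set R) z' -> z' <= K + K /\ 0 <= locmass T (H k) (x - z') by [].
  have := locmass_convp_ge T (H k) (cpoisson w G) x (K + K) L 0 _ set0 mI measurable0 hL h0 xK.
  rewrite mul0r addr0; apply: le_trans.
  by rewrite mulrC; apply: ler_wpM2l => //; exact: ltW.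
have := le_trans LF (h3 x xx3).
have sN : \sum_(0 <= n < N) pw n * (n%:R - d) =
    \sum_(0 <= n < N) n%:R * pw n - d * \sum_(0 <= n < N) pw n.
  by rewrite mulr_sumr -sumrB; apply: eq_bigr => n _; ring.
have s1 : d * \sum_(0 <= n < N) pw n <= d.
  by rewrite ler_piMr ?(ltW d0)// sum_poisson_weight_le1// ltW.
have : (W - 2 * d) * g x + p * ((1 - d) * z - 2 * g x) <= L.
  rewrite /L lerD2r ler_wpM2r// sN; lra.
have z0 : 0 <= z by exact: locmass_ge0.
have d1' : 0 <= 1 - d by lra.
move=> /(ler_wpM2l d1') i1 /(le_trans i1) i2.
have d1s : 0 < 1 - d by lra.
have p1d : 0 < p * ((1 - d) * (1 - d)) := mulr_gt0 p2 (mulr_gt0 d1s d1s).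
rewrite -(ler_pM2l p1d).
have dd : 0 <= d * d by rewrite mulr_ge0// ltW.
apply: (@le_trans _ _ ((2 * p + d * (3 + W)) * g x)).
  have -> : p * ((1 - d) * (1 - d)) * z =
    (1 - d) * ((W - 2 * d) * g x + p * ((1 - d) * z - 2 * g x)) -
    (1 - d) * ((W - 2 * d) - 2 * p) * g x by ring.
  apply: (@le_trans _ _ ((W + d) * g x - (1 - d) * ((W - 2 * d) - 2 * p) * g x)).
    by rewrite lerD2r.
  rewrite -mulrBl ler_wpM2r//.
  have : 0 <= d * p by rewrite mulr_ge0// ltW.
  lra.
rewrite [leRHS]mulrA; apply: ler_wpM2r => //.
have : 0 <= d * d * p * (2 + e) by rewrite mulr_ge0 ?(ltW e2)// mulr_ge0// ltW.
lra.
Qed.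

End converse.

(** * Asymptotic equivalence *)

Section asymptotic_equivalence.
Context {R : realType}.
Implicit Types u v : R -> R.

(** Division by 0 yields 0, so a ratio within distance 1 of 1 forces numerator and denominator to be
    nonzero. *)
Lemma asymp_equiv_pos u v : (forall x, 0 <= u x) -> (forall x, 0 <= v x) ->
  asymp_equiv u v -> \forall x \near +oo, 0 < u x /\ 0 < v x.
Proof.
move=> u0 v0 /cvgrPdist_lt /(_ 1 ltr01); apply: filterS => x h.
have [ux|ux] := eqVneq (u x) 0; first by rewrite ux mul0r subr0 normr1 ltxx in h.
have [vx|vx] := eqVneq (v x) 0; first by rewrite vx invr0 mulr0 subr0 normr1 ltxx in h.
by rewrite !lt_neqAle u0 v0 !(eq_sym 0) ux vx.
Qed.

Lemma asymp_equiv_bound u v : (forall x, 0 <= u x) -> (forall x, 0 <= v x) ->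
  asymp_equiv u v -> forall e : R, 0 < e ->
  \forall x \near +oo, (1 - e) * v x <= u x <= (1 + e) * v x.
Proof.
move=> u0 v0 uv e e0; move: (uv) => /cvgrPdist_le /(_ e e0) h.
apply: filterS2 (asymp_equiv_pos _ _ u0 v0 uv) h => x [ux vx] /= h'.
have {}h' : `|(1 : R) - u x / v x| <= e := h'.
move: h'; rewrite ler_distlC => /andP[h1 h2].
by apply/andP; split; [rewrite -ler_pdivlMr|rewrite -ler_pdivrMr].
Qed.

Lemma bound_asymp_equiv u v : (\forall x \near +oo, 0 < v x) ->
  (forall e : R, 0 < e -> \forall x \near +oo, (1 - e) * v x <= u x <= (1 + e) * v x) ->
  asymp_equiv u v.
Proof.
move=> v0 h; apply/cvgrPdist_le => e e0.
apply: filterS2 v0 (h e e0) => x vx /andP[h1 h2].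
suff : `|(1 : R) - u x / v x| <= e by [].
by rewrite ler_distlC; apply/andP; split; [rewrite ler_pdivlMr|rewrite ler_pdivrMr].
Qed.

Lemma asymp_equivC u v : asymp_equiv u v -> asymp_equiv v u.
Proof.
rewrite /asymp_equiv => uv.
have -> : (fun x => v x / u x) = (fun x => (u x / v x)^-1).
  by apply/funext => x; rewrite invf_div.
rewrite -[X in _ --> X]invr1; apply: cvgV => //; exact: oner_neq0.
Qed.

Lemma near_asymp_equiv u u' v : (\forall x \near +oo, u x = u' x) ->
  asymp_equiv u v <-> asymp_equiv u' v.
Proof.
move=> h; rewrite /asymp_equiv; split; apply: cvg_trans; apply: near_eq_cvg;
  by apply: filterS h => x ->.
Qed.

Lemma slowly_near u v : (forall x, 0 <= v x) -> slowly v ->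
  (forall e : R, 0 < e -> \forall x \near +oo, (1 - e) * v x <= u x <= (1 + e) * v x) ->
  slowly u.
Proof.
move=> v0 vs h K e e0.
have k0 : 0 < 4 + e by rewrite addr_gt0.
(* From e = (4 + e) d one gets (1 + e) (1 - d) = 1 + 3 d >= (1 + d)^2, and likewise (1 - e) (1 + d)
   <= (1 - d)^2. *)
pose d := e / (4 + e).
have d0 : 0 < d by rewrite divr_gt0.
have dE : (4 + e) * d = e by rewrite mulrC divfK// gt_eqF.
have d1 : d < 1 by rewrite /d ltr_pdivrMr// mul1r ltrDr.
have dd : 0 <= d * d by rewrite mulr_ge0// ltW.
have dd1 : d * d <= d by rewrite ler_piMl// ltW.
have ed : 0 <= e * d by rewrite mulr_ge0// ltW.
have /near_pinftyP[x1 x10 h1] := vs K d d0.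
have /near_pinftyP[x2 x20 h2] := h d d0.
apply/near_pinftyP; exists (x1 + x2); first by rewrite addr_ge0.
move=> x hx t tK.
have xx1 : x1 <= x by rewrite (le_trans _ hx)// lerDl.
have xx2 : x2 <= x by rewrite (le_trans _ hx)// lerDr.
have xt2 : x2 <= x + t by case/andP: tK => t0 _; rewrite (le_trans xx2)// lerDl.
have vx := v0 x.
have /andP[a1 a2] := h1 x xx1 t tK.
have /andP[b1 b2] := h2 x xx2.
have /andP[c1 c2] := h2 (x + t) xt2.
have d1' : 0 <= 1 - d by rewrite subr_ge0 ltW.
have d1p : 0 <= 1 + d by rewrite addr_ge0// ltW.
apply/andP; split.
  apply: le_trans c1; apply: le_trans (ler_wpM2l d1' a1).
  have [e1|e1] := leP 1 e.
    apply: (@le_trans _ _ 0); last by rewrite !mulr_ge0.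
    rewrite mulr_le0_ge0// ?subr_le0//.
    by apply: le_trans b1; rewrite mulr_ge0.
  have e1' : 0 <= 1 - e by rewrite subr_ge0 ltW.
  apply: (le_trans (ler_wpM2l e1' b2)).
  rewrite !mulrA; apply: ler_wpM2r => //; lra.
apply: (le_trans c2); apply: (le_trans (ler_wpM2l d1p a2)).
have e1' : 0 <= 1 + e by rewrite addr_ge0// ltW.
apply: le_trans (ler_wpM2l e1' b1).
rewrite !mulrA; apply: ler_wpM2r => //; lra.
Qed.

End asymptotic_equivalence.

(** * The two implications in terms of local masses *)

Section main_directions.
Context {R : realType} (T : \bar R) (G F : probability R R) (w : {nonneg R}).
Hypothesis G0 : G `]-oo, 0[%classic = 0%E.
Hypothesis G1 : pr G `]1, +oo[%classic = 1.
Let g := locmass T G.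
Let g_ge0 x : 0 <= g x. Proof. exact: locmass_ge0. Qed.
Let g2 := locmass T (convp G G).
Let W := w%:num.
Hypothesis W0 : 0 < W.
Variables (H : nat -> probability R R) (M : R).
Hypothesis H0 : forall k, H k `]-oo, 0[%classic = 0%E.
Hypothesis HM : forall k, (mgf 1 (H k) <= M%:E)%E.
Hypothesis HF : forall x, 0 <= x ->
  locmass T (convp (H k) (cpoisson w G)) x @[k --> \oo] --> locmass T F x.

Lemma direct_asymp : slowly g -> (\forall x \near +oo, 0 < g x) ->
  (forall e : R, 0 < e -> \forall x \near +oo, g2 x <= (2 + e) * g x) ->
  asymp_equiv (locmass T F) (fun x => W * g x).
Proof.
move=> gs gp hg2; pose c := locmass T (cpoisson w G).
have cg (e : R) : 0 < e -> \forall x \near +oo, (1 - e) * (W * g x) <= c x <= (1 + e) * (W * g x).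
  move=> e0; have We : 0 < W * e by rewrite mulr_gt0.
  have h1 := cpoisson_lower T G w G0 (W * e) (slowly_long_lower _ g_ge0 gs) We.
  have h2 := cpoisson_upper T G w G0 (W * e) gs gp hg2 We.
  apply: filterS2 h1 h2 => x; rewrite -/c -/g -/W => h1 h2; apply/andP; split.
    by apply: le_trans h1; rewrite le_eqVlt; apply/orP; left; apply/eqP; ring.
  by apply: (le_trans h2); rewrite le_eqVlt; apply/orP; left; apply/eqP; ring.
have wg0 x : 0 <= W * g x by rewrite mulr_ge0// ltW.
have wgs : slowly (fun x => W * g x).
  move=> K e e0; apply: filterS (gs K e e0) => x h t tK.
  by rewrite !(mulrCA _ W) !ler_pM2l// h.
have cs := slowly_near _ _ wg0 wgs cg.
have cp : \forall x \near +oo, 0 < c x.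
  have h0 : (0 : R) < 1 / 2 by rewrite divr_gt0.
  apply: filterS2 gp (cg _ h0) => x gx /andP[h _]; apply: lt_le_trans h.
  by rewrite !mulr_gt0//; lra.
have HM' k : (mgf 1 (H k) <= (`|M|)%:E)%E by rewrite (le_trans (HM k))// lee_fin ler_norm.
(* The bounds hold for every k from a common x0 on, so both pass to the limit k -> oo. *)
have Fc (e : R) : 0 < e -> \forall x \near +oo, (1 - e) * c x <= locmass T F x <= (1 + e) * c x.
  move=> e0; have /near_pinftyP[x0 x00 h] := light_perturbation T _ _ (normr_ge0 M) cs cp e e0.
  apply/near_pinftyP; exists x0 => // x xx0; apply/andP; split.
    apply: (cvgr_to_ge (HF x (le_trans x00 xx0))); apply: nearW => k.
    by have /andP[] := h x xx0 (H k) (H0 k) (HM' k).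
  apply: (cvgr_to_le (HF x (le_trans x00 xx0))); apply: nearW => k.
  by have /andP[] := h x xx0 (H k) (H0 k) (HM' k).
apply: bound_asymp_equiv; first by apply: filterS gp => x gx; rewrite mulr_gt0.
move=> e e0; pose d := Num.min (e / 3) 1.
have d0 : 0 < d by rewrite lt_min divr_gt0/=.
have d1 : d <= 1 by rewrite ge_min lexx orbT.
have de : 3 * d <= e by rewrite mulrC -ler_pdivlMr// ge_min lexx.
apply: filterS2 (cg d d0) (Fc d d0) => x /andP[a1 a2] /andP[b1 b2].
have dd1 : d * d <= d by rewrite ler_piMl// ltW.
have dd : 0 <= d * d by rewrite mulr_ge0// ltW.
have d1' : 0 <= 1 - d by rewrite subr_ge0.
have d1p : 0 <= 1 + d by rewrite addr_ge0// ltW.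
apply/andP; split.
  apply: le_trans b1; apply: le_trans (ler_wpM2l d1' a1).
  rewrite [leRHS]mulrA; apply: ler_wpM2r => //; lra.
apply: (le_trans b2); apply: (le_trans (ler_wpM2l d1p a2)).
rewrite [leLHS]mulrA; apply: ler_wpM2r => //; lra.
Qed.

Let F_upper : asymp_equiv (locmass T F) (fun x => W * g x) ->
  forall e : R, 0 < e -> \forall x \near +oo, locmass T F x <= (W + e) * g x.
Proof.
move=> FG e e0; have eW : 0 < e / W by rewrite divr_gt0.
have wg0 x : 0 <= W * g x by rewrite mulr_ge0// ltW.
have := asymp_equiv_bound _ _ (locmass_ge0 T F) wg0 FG _ eW.
apply: filterS => x /andP[_ h]; apply: (le_trans h).
by rewrite mulrA mulrDl mul1r divfK// gt_eqF.
Qed.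

(** [converse_g2] is used with s = K: by [locmass_convp_shift] the value at x - K is carried forward
    by K - y >= 0 to x - y, for all y in [0, K] at once. *)
Lemma converse_slowly : slowly g -> asymp_equiv (locmass T F) (fun x => W * g x) ->
  forall e : R, 0 < e -> \forall x \near +oo, g2 x <= (2 + e) * g x.
Proof.
move=> gs FG e e0.
pose d := Num.min (e / 4) 1.
have d0 : 0 < d by rewrite lt_min divr_gt0/=.
have d1 : d <= 1 by rewrite ge_min lexx orbT.
have de : 4 * d <= e by rewrite mulrC -ler_pdivlMr// ge_min lexx.
have [K K0 hK] := converse_g2 T G F w G0 W0 H M H0 HM HF
  (slowly_long_lower _ g_ge0 gs) (F_upper FG) d d0.
have hs : \forall x \near +oo, g2 (x - K) <= (2 + d) * g x.
  apply: hK => b b0; pose b' := Num.min (b / 4) 1.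
  have b'0 : 0 < b' by rewrite lt_min divr_gt0/=.
  have b'1 : b' <= 1 by rewrite ge_min lexx orbT.
  have bb : 4 * b' <= b by rewrite mulrC -ler_pdivlMr// ge_min lexx.
  have /near_pinftyP[A0 A00 hA0] := pr_near1 G b' G0 b'0.
  have /near_pinftyP[x3 x30 hx3] := slowly_long_upper g g_ge0 gs K b' b'0.
  pose A := Num.max A0 x3.
  have A0' : 0 <= A by rewrite le_max A00.
  have pA : 1 - b' <= pr G `[0, A]%classic by apply: hA0; rewrite le_max lexx.
  have b1p : 0 <= 1 + b' by rewrite addr_ge0// ltW.
  have b1i : 0 < 1 + b' by rewrite addr_gt0.
  have /near_pinftyP[x1 x10 h1] := slowly_long_upper g g_ge0 gs (K + A) b' b'0.
  have /near_pinftyP[x2 x20 h2] := slowly_long_lower g g_ge0 gs (K + A) b' b'0.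
  apply/near_pinftyP; exists (x1 + x2 + K + (A + A)); first by rewrite !addr_ge0.
  move=> x hx y /andP[y0 yK].
  have xx1 : x1 <= x by lra.
  have xx2 : x2 <= x by lra.
  have xA : A + A <= x - K by lra.
  have gx := g_ge0 x.
  have Ky0 : 0 <= K - y by rewrite subr_ge0.
  have hC u : A <= u -> locmass T G u <= (1 + b') * locmass T G (u + (K - y)).
    move=> Au; have t0K : 0 <= K - y <= K by rewrite Ky0 gerBl.
    have := hx3 (u + (K - y)) _ (K - y) t0K; rewrite addrK; apply.
    by apply: (le_trans _ (le_trans Au _)); [rewrite le_max lexx orbT|rewrite lerDl].
  have hal z : 0 <= z <= A -> locmass T G (x - K - z) <= (1 + b') * g x.
    move=> /andP[z0 zA]; rewrite -addrA -opprD; apply: h1 => //.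
    by rewrite addr_ge0//= lerD2l.
  have hal' z : 0 <= z <= A -> (1 - b') * g x <= locmass T G (x - K + (K - y) - z).
    move=> /andP[z0 zA]; have -> : x - K + (K - y) - z = x - (y + z) by ring.
    by apply: h2 => //; rewrite addr_ge0//= lerD.
  have al0 : 0 <= (1 + b') * g x by rewrite mulr_ge0.
  have := locmass_convp_shift T G (x - K) (K - y) A _ _ _ G0 al0 b1p A0' Ky0 xA hC hal hal'.
  have -> : x - K + (K - y) = x - y by ring.
  rewrite -/g2; set zK := g2 (x - K); set zy := g2 (x - y) => hz.
  have zK0 : 0 <= zK by exact: locmass_ge0.
  rewrite -(ler_pM2l b1i).
  have k1 : (1 - b') * g x * (1 - b') <= (1 - b') * g x * pr G `[0, A]%classic.
    by rewrite ler_wpM2l// mulr_ge0// subr_ge0.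
  have k2 := ler_wpM2l b1p k1.
  (* Since 4 b' <= b, (1 + b') (1 - b) <= 1. The error left by the shift is (1 + b') - (1 + b') (1 -
     b')^2 <= 4 b' times g x, within the allowed b. *)
  have e1 : (1 + b') * ((1 - b) * zK - b * g x) <= zK - 4 * b' * g x.
    have -> : (1 + b') * ((1 - b) * zK - b * g x) =
      (1 + b') * (1 - b) * zK - (1 + b') * b * g x by ring.
    have b'b : 0 <= b' * b by rewrite mulr_ge0// ltW.
    rewrite lerB//; last by rewrite ler_wpM2r//; lra.
    by rewrite ler_piMl//; lra.
  apply: (le_trans e1); rewrite lerBlDr; apply: (le_trans hz).
  have e2 : (1 + b') * ((1 - b') * g x * (1 - b')) = (1 - b' * (1 + b' - b' * b')) * g x.
    by ring.
  rewrite e2 in k2.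
  have e3 : 0 <= (1 - b') * b' * (2 + b') * g x.
    by rewrite !mulr_ge0 ?subr_ge0 ?(ltW b'0)// addr_ge0// ltW.
  have e4 : 0 <= b' * b' * b' * g x by rewrite !mulr_ge0// ltW.
  rewrite mulrBr.
  suff : (1 + b') * g x - (1 - b' * (1 + b' - b' * b')) * g x <= 4 * b' * g x by lra.
  by lra.
(* Read at x + K, the bound gives g2 x <= (2 + d) g (x + K) <= (2 + d) (1 + d) g x <= (2 + 4 d) g
   x. *)
have /near_pinftyP[x1 x10 h1] := hs.
have /near_pinftyP[x2 x20 h2] := gs K d d0.
apply/near_pinftyP; exists (x1 + x2); first by rewrite addr_ge0.
move=> x hx.
have xx1 : x1 <= x + K by rewrite (le_trans _ (le_trans hx _)) ?lerDl.
have xx2 : x2 <= x by rewrite (le_trans _ hx)// lerDr.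
have := h1 _ xx1; rewrite addrK => /le_trans; apply.
have KK : 0 <= K <= K by rewrite K0 lexx.
have /andP[_ h3] := h2 x xx2 K KK.
have d2 : 0 <= 2 + d by rewrite addr_ge0// ltW.
apply: (le_trans (ler_wpM2l d2 h3)).
rewrite mulrA; apply: ler_wpM2r => //.
have dd1 : d * d <= d by rewrite ler_piMl// ltW.
lra.
Qed.

(** Tails are monotone, so [long_lower] and the comparison in [converse_g2], now with s = 0, hold
    without any regularity of G. *)
Lemma converse_tail : T = +oo%E -> asymp_equiv (locmass T F) (fun x => W * g x) ->
  slowly g /\ forall e : R, 0 < e -> \forall x \near +oo, g2 x <= (2 + e) * g x.
Proof.
move=> Ty FG.
have mono (P : probability R R) x y : 0 <= y -> locmass T P x <= locmass T P (x - y).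
  move=> y0; apply: le_pr; try exact: measurable_shiftD.
  rewrite Ty /shiftD/= => z [xz _]; split; last by rewrite addey// leey.
  by apply: le_lt_trans xz; rewrite gerBl.
have gl : long_lower g.
  move=> K e e0; apply: nearW => x y /andP[y0 _]; apply: le_trans (mono G x y y0).
  by rewrite ler_piMl// gerBl ltW.
have hg2 (e : R) : 0 < e -> \forall x \near +oo, g2 x <= (2 + e) * g x.
  move=> e0; have [K K0 hK] := converse_g2 T G F w G0 W0 H M H0 HM HF gl (F_upper FG) e e0.
  have : \forall x \near +oo, g2 (x - 0) <= (2 + e) * g x.
    apply: hK => d d0; apply: nearW => x y /andP[y0 _].
    rewrite subr0 -/g2 -/g; apply: (@le_trans _ _ (g2 x)); last exact: mono.
    have g2x : 0 <= g2 x by exact: locmass_ge0.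
    have : 0 <= d * g2 x by rewrite mulr_ge0// ltW.
    have : 0 <= d * g x by rewrite mulr_ge0// ltW.
    lra.
  by apply: filterS => x; rewrite subr0.
split => //; apply: slowly_unit => // e e0.
pose d := Num.min (e / 5) (1 / 2).
have d0 : 0 < d by rewrite lt_min !divr_gt0.
have d1 : d <= 1 / 2 by rewrite ge_min lexx orbT.
have de : 5 * d <= e by rewrite mulrC -ler_pdivlMr// ge_min lexx.
have /near_pinftyP[A A0 hA] := pr_near1 G d G0 d0.
have pA := hA A (lexx _).
have m0A : measurable (`[0, A]%classic : set R) by exact: measurable_itv.
have m1A : measurable (`]1, A]%classic : set R) by exact: measurable_itv.
have p1A : 1 - d <= pr G `]1, A]%classic.
  have GA : pr G `]A, +oo[%classic <= d.
    have h : pr G `]A, +oo[%classic + pr G `[0, A]%classic <= 1.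
      rewrite -prU//; first by apply: pr_le1; exact: measurableU.
      rewrite disj_set2E; apply/eqP; rewrite -subset0 => y [] /=.
      by rewrite !in_itv/= andbT => /lt_le_trans h /andP[_ /h]; rewrite ltxx.
    lra.
  have h : pr G `]1, +oo[%classic <= pr G `]1, A]%classic + pr G `]A, +oo[%classic.
    apply: (@le_trans _ _ (pr G (`]1, A]%classic `|` `]A, +oo[%classic))); last first.
      by apply: prU_le => //; exact: measurable_itv.
    apply: le_pr => //; first by apply: measurableU => //; exact: measurable_itv.
    move=> y /=; rewrite !in_itv/= !andbT => y1.
    by have [yA|yA] := leP y A; [left; rewrite y1|right].
  by rewrite G1 in h; lra.
have /near_pinftyP[x2 x20 h2] := hg2 d d0.
have /near_pinftyP[x1 x10 h1] : \forall x \near +oo, g (x - 1) * (1 - e) <= g x.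
  apply/near_pinftyP; exists (x2 + (A + A)); first by rewrite !addr_ge0.
  move=> x hx.
  have xx2 : x2 <= x by rewrite (le_trans _ hx)// lerDl addr_ge0.
  have xA : A + A <= x by rewrite (le_trans _ hx)// lerDr.
  have hU y : `]1, A]%classic y -> y <= A /\ g (x - 1) <= locmass T G (x - y).
    rewrite /= in_itv/= => /andP[y1 yA]; split => //.
    have -> : x - y = x - 1 - (y - 1) by ring.
    by apply: mono; rewrite subr_ge0 ltW.
  have hV y : `[0, A]%classic y -> y <= A /\ g x <= locmass T G (x - y).
    by rewrite /= in_itv/= => /andP[y0 yA]; split => //; exact: mono.
  have := locmass_convp_ge T G G x A _ _ _ _ m1A m0A hU hV xA.
  move=> /le_trans /(_ (h2 x xx2)) h.
  have gx := g_ge0 x; have gx1 := g_ge0 (x - 1).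
  have i1 := ler_wpM2l gx1 p1A; have i2 := ler_wpM2l gx pA.
  (* This comes from (1 - d) (g (x - 1) + g x) <= (2 + d) g x. *)
  have i3 : (1 - d) * g (x - 1) <= (1 + 2 * d) * g x by lra.
  have [e1|e1] := leP 1 e.
    by apply: le_trans gx; rewrite mulr_ge0_le0// subr_le0.
  have e1' : 0 <= 1 - e by rewrite subr_ge0 ltW.
  have d1s : 0 < 1 - d by lra.
  rewrite -(ler_pM2l d1s) mulrA mulrC; apply: (le_trans (ler_wpM2l e1' i3)).
  rewrite mulrA; apply: ler_wpM2r => //.
  have : 0 <= e * d by rewrite mulr_ge0// ltW.
  lra.
have g1 x t : 0 <= t -> g (x + t) <= g x.
  by move=> t0; have := mono G (x + t) t t0; rewrite addrK.
apply/near_pinftyP; exists x1 => // x xx1 t /andP[t0 t1].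
apply/andP; split; last first.
  by apply: (le_trans (g1 x t t0)); rewrite ler_peMl// lerDl ltW.
have xx1' : x1 <= x + 1 by rewrite (le_trans xx1)// lerDl.
have := h1 (x + 1) xx1'; rewrite addrK mulrC => /le_trans; apply.
have -> : x + 1 = x + t + (1 - t) by ring.
by apply: g1; rewrite subr_ge0.
Qed.

End main_directions.

Theorem theorem7 (R : realType) (F : probability R R)
  (a : R) (nu : {measure set R -> \bar R}) (mu : R)
  (G : {measure set R -> \bar R}) (T : \bar R) :
  F (`]-oo, 0[)%classic = 0%E ->
  0 <= a ->
  nu (`]-oo, 0])%classic = 0%E ->
  nu (`]1, +oo[)%classic = mu%:E ->
  0 < mu ->
  (\int[nu]_(x in (`]0%R, 1%R])%classic) x%:E < +oo)%E ->
  (forall lambda : R, 0 <= lambda ->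
     (\int[F]_(x in (`[0%R, +oo[)%classic) (expR (- (lambda * x))%R)%:E)%E =
     expeR ((- (a * lambda))%:E
            - \int[nu]_(x in (`]0%R, +oo[)%classic) (1 - expR (- (lambda * x)))%R%:E)%E) ->
  (forall B, measurable B -> G B = (nu (B `&` (`]1%R, +oo[)%classic) * (mu^-1)%:E)%E) ->
  (0 < T)%E ->
  (T != +oo%E -> in_L_Delta T G) ->
  (in_S_Delta T G <->
   asymp_equiv (fun x => fine (nu (shiftD T x))) (fun x => fine (F (shiftD T x)))).
Proof.
move=> F0 a0 nu0 nu1 mu0 nuI lapF hG T0 GL.
have m1y : measurable (`]1, +oo[%classic : set R) by exact: measurable_itv.
have s1y : `]1, +oo[%classic `<=` (`]0, +oo[%classic : set R).
  by move=> x /=; rewrite !in_itv/= !andbT; apply: lt_trans.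
have nu1y : (nu `]1%R, +oo[%classic < +oo)%E by rewrite nu1 ltry.
(* [P] will be G packaged as a [probability], and [w] is mu. *)
have [w [P [hP hP0]]] := restricts_ex nu _ m1y s1y nu1y.
have wmu : w%:num = mu.
  have := hP setT measurableT; rewrite setTI prT mulr1 nu1.
  by case.
have w0 : 0 < w%:num by rewrite wmu.
have P0 : P `]-oo, 0[%classic = 0%E.
  apply: hP0; [exact: measurable_itv| |by rewrite /= in_itv/= ltxx].
  rewrite -subset0 => x [/= + /s1y/=]; rewrite !in_itv/= andbT => h1 /(lt_trans h1).
  by rewrite ltxx.
have P1 : pr P `]1, +oo[%classic = 1.
  have := hP _ m1y; rewrite setIid nu1 wmu => -[h].
  by apply: (mulfI (lt0r_neq0 mu0)); rewrite mulr1 -h.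
have GP B : measurable B -> G B = P B.
  by move=> mB; rewrite hG// hP// wmu -EFinM mulrAC mulfV ?mul1r ?gt_eqF// prE.
have tlG x : fine (G (shiftD T x)) = locmass T P x.
  by rewrite GP//; exact: measurable_shiftD.
have tlGG x : fine (Defs.conv G G (shiftD T x)) = locmass T (convp P P) x.
  rewrite /locmass /pr; congr fine; have mS := measurable_shiftD T x.
  transitivity (\int[P]_u \int[P]_v (\1_(shiftD T x) (u + v) : R)%:E)%E.
    rewrite /Defs.conv (@eq_measure_integral _ _ _ setT P); last by move=> A mA _; exact: GP.
    by apply: eq_integral => u _; apply: eq_measure_integral => A mA _; exact: GP.
  rewrite -(ge0_integral_convp P P (fun z => (\1_(shiftD T x) z : R)%:E))//.
    by rewrite integral_indic// setIT.
  by apply/measurable_EFinP; exact: measurable_indic.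
have nuE : \forall x \near +oo, fine (nu (shiftD T x)) = mu * locmass T P x.
  (* From x = 1 on, x + Delta lies in (1, oo), where nu is mu times G. *)
  apply/near_pinftyP; exists 1 => // x x1.
  rewrite -wmu -[RHS]/(fine (w%:num * pr P (shiftD T x))%:E) -hP; last exact: measurable_shiftD.
  congr (fine (nu _)); apply/esym/setIidl => y [xy _].
  by rewrite /= in_itv/= andbT (le_lt_trans x1).
have [H [M [H0 HM HF]]] := levy_approx F a nu w P a0 nuI lapF hP P0.
have {}HF x : 0 <= x ->
    locmass T (convp (H k) (cpoisson w P)) x @[k --> \oo] --> locmass T F x.
  by move=> x0; exact: HF.
have tlP0 x : 0 <= locmass T P x := locmass_ge0 T P x.
have L_slowly : in_L_Delta T G -> slowly (locmass T P) /\ \forall x \near +oo, 0 < locmass T P x.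
  move=> [pos L].
  have gp : \forall x \near +oo, 0 < locmass T P x.
    apply: filterS pos => x.
    by rewrite GP; [rewrite EFin_locmass lte_fin|exact: measurable_shiftD].
  split => //; apply: slowly_unit => // e e0.
  apply: filterS2 gp (L e e0) => x gx h t t01.
  have := h t t01; rewrite !tlG ltr_distl => /andP[h1 h2].
  by apply/andP; split; [rewrite -ler_pdivlMr// ltW|rewrite -ler_pdivrMr// ltW].
have slowly_L : slowly (locmass T P) -> (\forall x \near +oo, 0 < locmass T P x) -> in_L_Delta T G.
  move=> gs gp; split.
    apply: filterS gp => x gx.
    by rewrite GP; [rewrite EFin_locmass lte_fin|exact: measurable_shiftD].
  move=> e e0; have e20 : 0 < e / 2 by rewrite divr_gt0.
  apply: filterS2 gp (gs 1 _ e20) => x gx h t t01.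
  have /andP[h1 h2] := h t t01; rewrite !tlG.
  apply: (@le_lt_trans _ _ (e / 2)); last by rewrite ltr_pdivrMr// ltr_pMr// ltr1n.
  by rewrite ler_distl ler_pdivlMr// ler_pdivrMr// h1.
have nuF : asymp_equiv (fun x => fine (nu (shiftD T x))) (fun x => fine (F (shiftD T x))) <->
    asymp_equiv (locmass T F) (fun x => w%:num * locmass T P x).
  rewrite wmu (near_asymp_equiv _ _ _ nuE); split; exact: asymp_equivC.
rewrite nuF; split.
  move=> [_ [_ [GLd GS]]].
  have [gs gp] := L_slowly GLd.
  apply: (direct_asymp _ _ _ _ P0 w0 H M H0 HM HF gs gp) => e e0.
  have e20 : 0 < e / 2 by rewrite divr_gt0.
  have gg0 x : 0 <= locmass T (convp P P) x := locmass_ge0 T _ x.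
  have g20 x : 0 <= 2 * locmass T P x by rewrite mulr_ge0.
  have GS' : asymp_equiv (locmass T (convp P P)) (fun x => 2 * locmass T P x).
    have e1 : (fun x => fine (Defs.conv G G (shiftD T x))) = locmass T (convp P P).
      by apply/funext => x; exact: tlGG.
    have e2 : (fun x => 2 * fine (G (shiftD T x))) = (fun x => 2 * locmass T P x).
      by apply/funext => x; rewrite tlG.
    by rewrite -e1 -e2.
  apply: filterS (asymp_equiv_bound _ _ gg0 g20 GS' _ e20) => x /andP[_ h].
  by apply: (le_trans h); rewrite le_eqVlt; apply/orP; left; apply/eqP; field.
move=> FG.
(* Positivity is implicit in the ratio tending to 1; for T = oo no assumption on G provides it. *)
have gp : \forall x \near +oo, 0 < locmass T P x.
  have wg0 x : 0 <= w%:num * locmass T P x by rewrite mulr_ge0.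
  apply: filterS (asymp_equiv_pos _ _ (locmass_ge0 T F) wg0 FG) => x [_].
  by rewrite pmulr_rgt0.
have [gs hg2] : slowly (locmass T P) /\ forall e : R, 0 < e ->
    \forall x \near +oo, locmass T (convp P P) x <= (2 + e) * locmass T P x.
  have [Ty|Ty] := eqVneq T +oo%E.
    exact: (converse_tail _ _ _ _ P0 P1 w0 H M H0 HM HF Ty FG).
  have [gs _] := L_slowly (GL Ty); split => //.
  exact: (converse_slowly _ _ _ _ P0 w0 H M H0 HM HF gs FG).
have unb x : (0 < P `]x, +oo[%classic)%E.
  have /near_pinftyP[x0 x00 h] := gp.
  have h0 := h (Num.max x x0) _; rewrite le_max lexx orbT in h0.
  apply: (@lt_le_trans _ _ (P (shiftD T (Num.max x x0)))).
    by rewrite EFin_locmass lte_fin h0.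
  apply: le_measure; rewrite ?inE//; first exact: measurable_shiftD.
  by move=> y [+ _]; rewrite /= in_itv/= andbT gt_max => /andP[].
split; first by rewrite GP.
split; first by move=> x; rewrite GP.
split; first exact: slowly_L.
have -> : (fun x => fine (Defs.conv G G (shiftD T x))) = locmass T (convp P P).
  by apply/funext => x; exact: tlGG.
have -> : (fun x => 2 * fine (G (shiftD T x))) = (fun x => 2 * locmass T P x).
  by apply/funext => x; rewrite tlG.
apply: bound_asymp_equiv; first by apply: filterS gp => x gx; rewrite mulr_gt0.
move=> e e0.
(* The lower half of the equivalence holds for every long-tailed law; only the upper half needed the
   behaviour of F. *)
have := convpow_lower T P P0 2 0 e (slowly_long_lower _ tlP0 gs) e0.
apply: filterS2 (hg2 e e0) => x h2 /(_ 0); rewrite subr0 lexx => /(_ isT).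
rewrite locmass_convpow2 => h1.
have : 0 <= e * locmass T P x by rewrite mulr_ge0// ltW.
by move=> he; apply/andP; split; lra.
Qed.
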